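(* Let $R$ be a commutative noetherian ring with classical ring of quotients $Q$. Then the following are equivalent: (i) The cotorsion pair $(\mathcal{P}_1,\mathcal{P}_1^{\perp})$ of $R$-modules is of finite type. (ii) $\mathrm{F.dim}\,Q=0$. (iii) $Q$ is artinian. (iv) The set of prime ideals associated to $R$ coincides with the set of minimal prime ideals of $R$.
   Context: $Q$ is the total ring of fractions of $R$, i.e. the localization of $R$ at the set of its non zero divisors. $\mathcal{P}_1$ is the class of $R$-modules of projective dimension at most $1$. For a class $\mathcal{C}$ of $R$-modules, $\mathcal{C}^{\perp}=\{X : \mathrm{Ext}_R^i(C,X)=0 \text{ for all } C\in\mathcal{C},\ i\ge 1\}$, ${}^{\perp}\mathcal{C}=\{X : \mathrm{Ext}_R^i(X,C)=0 \text{ for all } C\in\mathcal{C},\ i\ge 1\}$. A hereditary cotorsion pair is a pair $(\mathcal{A},\mathcal{B})$ with $\mathcal{A}={}^{\perp}\mathcal{B}$, $\mathcal{B}=\mathcal{A}^{\perp}$; $(\mathcal{P}_1,\mathcal{P}_1^{\perp})$ is one. It is of finite type if there is a class $\mathcal{S}$ of modules having a projective resolution by finitely generated projective modules such that $\mathcal{S}^{\perp}=\mathcal{B}$. $\mathrm{F.dim}\,Q$ (big finitistic dimension) is the supremum of the projective dimensions of the $Q$-modules of finite projective dimension. *)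

(* Defs.v *)
From HB Require Import structures.
From mathcomp Require Import all_boot all_order all_algebra ring.
From mathcomp Require Import boolp classical_sets.

Set Implicit Arguments.
Unset Strict Implicit.
Unset Printing Implicit Defensive.

Import GRing.Theory.
Local Open Scope ring_scope.
Local Open Scope quotient_scope.
Local Open Scope classical_set_scope.

(* [{fraction R}] of the library needs an integral domain, so the localization
   at the non zero divisors is built here.  [GRing.lreg s], the injectivity of
   multiplication by [s], says that [s] is not a zero divisor. *)
Section TotalFractions.
Variable R : comPzRingType.

Record tfrac := Tfrac { tpair :> R * R; _ : `[< GRing.lreg tpair.2 >] }.

HB.instance Definition _ := [isSub for tpair].
HB.instance Definition _ := [Choice of tfrac by <:].

Definition mk_tfrac (a s : R) (hs : GRing.lreg s) : tfrac :=
  @Tfrac (a, s) (asboolT (hs : GRing.lreg (a, s).2)).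

Lemma tden_lreg (x : tfrac) : GRing.lreg x.2.
Proof. by case: x => p /= /asboolP. Qed.

(* The usual extra factor [u (a t - b s) = 0] is not needed, as [u] would not
   be a zero divisor. *)
Definition equivt (x y : tfrac) := x.1 * y.2 == y.1 * x.2.

Lemma equivt_refl : reflexive equivt.
Proof. by move=> x; exact: eqxx. Qed.

Lemma equivt_sym : symmetric equivt.
Proof. by move=> x y; rewrite /equivt eq_sym. Qed.

Lemma equivt_trans : transitive equivt.
Proof.
move=> y x z /eqP xy /eqP yz; apply/eqP/(tden_lreg (x := y)).
have -> : y.2 * (x.1 * z.2) = x.1 * y.2 * z.2 by ring.
have -> : y.2 * (z.1 * x.2) = z.1 * y.2 * x.2 by ring.
by rewrite xy -yz; ring.
Qed.

Canonical equivt_equiv := EquivRel equivt equivt_refl equivt_sym equivt_trans.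

Definition total_fractions := {eq_quot equivt}.

HB.instance Definition _ : EqQuotient _ equivt total_fractions :=
  EqQuotient.on total_fractions.
HB.instance Definition _ := Choice.on total_fractions.

Lemma equivt_l (x : tfrac) :
  (repr (\pi_total_fractions x)).1 * x.2
  = x.1 * (repr (\pi_total_fractions x)).2.
Proof.
have : \pi_total_fractions (repr (\pi_total_fractions x))
       = \pi_total_fractions x by rewrite reprK.
by move/eqmodP/eqP.
Qed.

Definition tadd (x y : tfrac) : tfrac :=
  mk_tfrac (x.1 * y.2 + y.1 * x.2)
    (lregM (tden_lreg (x := x)) (tden_lreg (x := y))).
Definition topp (x : tfrac) : tfrac := mk_tfrac (- x.1) (tden_lreg (x := x)).
Definition tmul (x y : tfrac) : tfrac :=
  mk_tfrac (x.1 * y.1) (lregM (tden_lreg (x := x)) (tden_lreg (x := y))).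

Definition tf_add := lift_op2 total_fractions tadd.
Definition tf_opp := lift_op1 total_fractions topp.
Definition tf_mul := lift_op2 total_fractions tmul.
Definition to_total_fractions (a : R) : total_fractions :=
  \pi_total_fractions (mk_tfrac a (@lreg1 R)).

Lemma pi_tadd : {morph \pi_total_fractions : x y / tadd x y >-> tf_add x y}.
Proof.
move=> x y; unlock tf_add; apply/eqmodP; rewrite /= /equivt /tadd /=.
apply/eqP; set x' := repr _; set y' := repr _.
have Ex : x'.1 * x.2 = x.1 * x'.2 by exact: equivt_l.
have Ey : y'.1 * y.2 = y.1 * y'.2 by exact: equivt_l.
have -> : (x'.1 * y'.2 + y'.1 * x'.2) * (x.2 * y.2)
  = x'.1 * x.2 * (y'.2 * y.2) + y'.1 * y.2 * (x'.2 * x.2) by ring.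
by rewrite Ex Ey; ring.
Qed.

Lemma pi_topp : {morph \pi_total_fractions : x / topp x >-> tf_opp x}.
Proof.
move=> x; unlock tf_opp; apply/eqmodP; rewrite /= /equivt /topp /=.
by rewrite !mulNr equivt_l.
Qed.

Lemma pi_tmul : {morph \pi_total_fractions : x y / tmul x y >-> tf_mul x y}.
Proof.
move=> x y; unlock tf_mul; apply/eqmodP; rewrite /= /equivt /tmul /=.
by rewrite mulrACA -!equivt_l mulrACA.
Qed.

Local Notation tpi := (\pi_total_fractions).

Lemma tpi_eq (x y : tfrac) : x.1 * y.2 = y.1 * x.2 -> tpi x = tpi y.
Proof. by move=> e; apply/eqmodP/eqP. Qed.

Lemma tf_addA : associative tf_add.
Proof.
elim/quotW=> x; elim/quotW=> y; elim/quotW=> z; rewrite -!pi_tadd.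
by apply: tpi_eq => /=; ring.
Qed.

Lemma tf_addC : commutative tf_add.
Proof.
elim/quotW=> x; elim/quotW=> y; rewrite -!pi_tadd.
by apply: tpi_eq => /=; ring.
Qed.

Lemma tf_add0 : left_id (to_total_fractions 0) tf_add.
Proof.
elim/quotW=> x; rewrite -pi_tadd.
by apply: tpi_eq => /=; rewrite mul0r add0r mulr1 mul1r.
Qed.

Lemma tf_addN : left_inverse (to_total_fractions 0) tf_opp tf_add.
Proof.
elim/quotW=> x; rewrite -pi_topp -pi_tadd.
by apply: tpi_eq => /=; rewrite mulNr addNr !mul0r.
Qed.

HB.instance Definition _ := GRing.isZmodule.Build total_fractions
  tf_addA tf_addC tf_add0 tf_addN.

Lemma tf_mulA : associative tf_mul.
Proof.
elim/quotW=> x; elim/quotW=> y; elim/quotW=> z; rewrite -!pi_tmul.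
by apply: tpi_eq => /=; rewrite !mulrA.
Qed.

Lemma tf_mulC : commutative tf_mul.
Proof.
elim/quotW=> x; elim/quotW=> y; rewrite -!pi_tmul.
by apply: tpi_eq => /=; ring.
Qed.

Lemma tf_mul1 : left_id (to_total_fractions 1) tf_mul.
Proof.
by elim/quotW=> x; rewrite -pi_tmul; apply: tpi_eq => /=; rewrite !mul1r.
Qed.

Lemma tf_mulDl : left_distributive tf_mul tf_add.
Proof.
elim/quotW=> x; elim/quotW=> y; elim/quotW=> z; rewrite -!(pi_tadd, pi_tmul).
by apply: tpi_eq => /=; ring.
Qed.

HB.instance Definition _ := GRing.Zmodule_isComPzRing.Build total_fractions
  tf_mulA tf_mulC tf_mul1 tf_mulDl.

Lemma to_total_fractions_zmod : zmod_morphism to_total_fractions.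
Proof.
move=> a b; rewrite /GRing.add /GRing.opp /= -pi_topp -pi_tadd.
by apply: tpi_eq => /=; rewrite !mulr1.
Qed.

Lemma to_total_fractions_monoid : monoid_morphism to_total_fractions.
Proof.
split=> // a b; rewrite [RHS]/GRing.mul /= -pi_tmul.
by apply: tpi_eq => /=; rewrite !mulr1.
Qed.

HB.instance Definition _ := GRing.isZmodMorphism.Build R total_fractions
  to_total_fractions to_total_fractions_zmod.
HB.instance Definition _ := GRing.isMonoidMorphism.Build R total_fractions
  to_total_fractions to_total_fractions_monoid.

Lemma to_total_fractions_inj : injective to_total_fractions.
Proof. by move=> a b /eqmodP/eqP /=; rewrite !mulr1. Qed.

Lemma to_total_fractions_unit (s : R) : GRing.lreg s ->
  exists q : total_fractions, q * to_total_fractions s = 1.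
Proof.
move=> hs; exists (tpi (mk_tfrac 1 hs)).
rewrite /GRing.mul /= -pi_tmul.
by apply: tpi_eq => /=; rewrite !mul1r mulr1.
Qed.

Lemma total_fractionsP (q : total_fractions) :
  exists a s : R, GRing.lreg s /\
    q * to_total_fractions s = to_total_fractions a.
Proof.
elim/quotW: q => x; exists x.1, x.2; split; first exact: tden_lreg.
by rewrite /GRing.mul /= -pi_tmul; apply: tpi_eq => /=; rewrite !mulr1.
Qed.

End TotalFractions.

Section Ideals.
Variable R : comPzRingType.
Implicit Types I p : set R.

Definition ideal I :=
  [/\ I 0, forall a b, I a -> I b -> I (a + b) & forall r a, I a -> I (r * a)].

Definition prime_ideal p :=
  [/\ ideal p, ~ p 1 & forall a b, p (a * b) -> p a \/ p b].

Definition minimal_primes : set (set R) :=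
  [set p | prime_ideal p /\ forall q, prime_ideal q -> q `<=` p -> q = p].

Definition associated_primes : set (set R) :=
  [set p | prime_ideal p /\ exists x : R, p = [set a | a * x = 0]].

Definition noetherian :=
  forall I : nat -> set R, (forall n, ideal (I n)) ->
    (forall n, I n `<=` I n.+1) ->
    exists m, forall n, (m <= n)%N -> I n = I m.

Definition artinian :=
  forall I : nat -> set R, (forall n, ideal (I n)) ->
    (forall n, I n.+1 `<=` I n) ->
    exists m, forall n, (m <= n)%N -> I n = I m.

End Ideals.

Arguments minimal_primes : clear implicits.
Arguments associated_primes : clear implicits.
Arguments noetherian : clear implicits.
Arguments artinian : clear implicits.

Section Homological.
Variable R : comPzRingType.

Definition projective (P : lmodType R) :=
  forall (A B : lmodType R) (g : {linear A -> B}) (f : {linear P -> B}),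
    (forall b, exists a, g a = b) ->
    exists h : {linear P -> A}, forall x, g (h x) = f x.

Definition finitely_generated (M : lmodType R) :=
  exists (n : nat) (v : 'I_n -> M),
    forall x, exists c : 'I_n -> R, x = \sum_i c i *: v i.

Record proj_resolution (M : lmodType R) := ProjResolution {
  res_mod :> nat -> lmodType R;
  res_diff : forall n, {linear res_mod n.+1 -> res_mod n};
  res_aug : {linear res_mod 0 -> M};
  res_proj : forall n, projective (res_mod n);
  res_surj : forall x, exists y, res_aug y = x;
  res_exact0 : forall y, res_aug y = 0 <-> exists z, res_diff 0 z = y;
  res_exactS : forall n y,
    res_diff n y = 0 <-> exists z, res_diff n.+1 z = y
}.

Definition pdim_le (M : lmodType R) (n : nat) :=
  exists P : proj_resolution M, forall k, (n < k)%N -> forall x : P k, x = 0.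

(* The zero module has projective dimension 0. *)
Definition has_pdim (M : lmodType R) (n : nat) :=
  pdim_le M n /\ forall m, pdim_le M m -> (n <= m)%N.

Section HomComplex.
Variables (M N : lmodType R) (P : proj_resolution M).

Definition cocycle (i : nat) (f : {linear P i -> N}) :=
  forall y, f (res_diff P i y) = 0.

Definition coboundary (i : nat) : {linear P i -> N} -> Prop :=
  match i return {linear P i -> N} -> Prop with
  | 0%N => fun f => forall x, f x = 0
  | j.+1 => fun f =>
      exists g : {linear P j -> N}, forall x, f x = g (res_diff P j x)
  end.

End HomComplex.

(* [Ext^i(M, N) = 0]: the [i]-th cohomology of [Hom(P, N)] vanishes.  Ext does
   not depend on the projective resolution [P] of [M]. *)
Definition Ext_eq0 (i : nat) (M N : lmodType R) :=
  forall (P : proj_resolution M) (f : {linear P i -> N}),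
    cocycle f -> coboundary f.

Definition mod_class := lmodType R -> Prop.

Definition pdim_le1 : mod_class := fun M => pdim_le M 1.

Definition right_perp (C : mod_class) : mod_class :=
  fun X => forall M, C M -> forall i, (1 <= i)%N -> Ext_eq0 i M X.

Definition left_perp (C : mod_class) : mod_class :=
  fun X => forall M, C M -> forall i, (1 <= i)%N -> Ext_eq0 i X M.

Definition same_class (C D : mod_class) := forall M, C M <-> D M.

Definition hereditary_cotorsion_pair (A B : mod_class) :=
  same_class A (left_perp B) /\ same_class B (right_perp A).

Definition has_fg_proj_resolution (M : lmodType R) :=
  exists P : proj_resolution M, forall n, finitely_generated (P n).

Definition cotorsion_pair_of_finite_type (A B : mod_class) :=
  hereditary_cotorsion_pair A B /\
  exists S : mod_class,
    (forall M, S M -> has_fg_proj_resolution M) /\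
    same_class (right_perp S) B.

(* The big finitistic dimension, as the least upper bound in [nat] of a set of
   projective dimensions; it holds of no [d] if that set is unbounded. *)
Definition is_Fdim (d : nat) :=
  supremums [set n | exists M : lmodType R, has_pdim M n] d.

End Homological.

Arguments pdim_le1 : clear implicits.
Arguments is_Fdim : clear implicits.

(* Main.v *)
Require Import Defs.
From HB Require Import structures.
From mathcomp Require Import all_boot all_order all_algebra ring.
From mathcomp Require Import boolp classical_sets functions.

Set Implicit Arguments.
Unset Strict Implicit.
Unset Printing Implicit Defensive.

Import GRing.Theory.
Local Open Scope ring_scope.
Local Open Scope quotient_scope.
Local Open Scope classical_set_scope.

(* All four conditions are shown equivalent to the following one: for every s in
   R there are n and a non zero divisor u with u s^n in s^(n+1) R.

   If F.dim Q = 0, the colimit of the maps s : Q -> Q -> ..., of projective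
   dimension at most 1, is projective, so the powers s^n Q stabilize.  If P_1^perp
   is of finite type, it contains Q^(N): an injection K -> G of projectives with K
   finitely generated has, over a noetherian ring, a retraction up to a non zero
   divisor, so divisible modules are orthogonal to the finitely presented modules
   in P_1.  Extending along R^(N) -> R^(N), e_n |-> e_n - s e_(n+1), into Q^(N)
   gives the same conclusion.

   Conversely, noetherian induction on the annihilator of Y shows that every
   injection F -> G of projectives has the extension property for the modules Y
   on which non zero divisors act bijectively: for Y killed by a prime p, one has
   p = ann x for some x, and x detects p F inside p G.  Hence F becomes a summand
   of G over Q.  The splitting closes off countably many basis elements of F and G
   at a time; inside such a block its denominators can be cleared on finite pieces,
   so a map from F into a divisible module extension_le to G.  Thus P_1^perp consists of
   the divisible modules and S = {R/uR} is of finite type for it. *)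

(** * Submodules, quotients and free modules *)

Definition mkLin (R : pzRingType) (A B : lmodType R) (f : A -> B)
  (hf : linear f) : {linear A -> B} :=
  HB.pack f (GRing.isLinear.Build R A B *:%R f hf).

Record submod (R : pzRingType) (M : lmodType R) := Submod {
  smem :> M -> Prop;
  smem0 : smem 0;
  smemL : forall a x y, smem x -> smem y -> smem (a *: x + y) }.

Section Submodule.
Variables (R : pzRingType) (M : lmodType R) (S : submod M).

Lemma smemD x y : S x -> S y -> S (x + y).
Proof. by move=> hx hy; rewrite -[x]scale1r; apply: smemL. Qed.

Lemma smemZ a x : S x -> S (a *: x).
Proof. by move=> hx; rewrite -[_ *: _]addr0; apply: smemL => //; apply: smem0. Qed.

Lemma smemN x : S x -> S (- x).
Proof. by move=> hx; rewrite -scaleN1r; apply: smemZ. Qed.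

Lemma smemB x y : S x -> S y -> S (x - y).
Proof. by move=> hx hy; apply: smemD => //; apply: smemN. Qed.

Lemma smem_sum (I : Type) (s : seq I) (P : pred I) (f : I -> M) :
  (forall i, P i -> S (f i)) -> S (\sum_(i <- s | P i) f i).
Proof.
by move=> hf; elim/big_ind: _ => //; [exact: smem0 | exact: smemD].
Qed.

(** Boolean form of the membership, from which the module structure on the subtype is inherited. *)
Definition spred : {pred M} := fun x => `[< S x >].

Lemma spred_closed : submod_closed spred.
Proof.
split; first exact/asboolP/smem0.
by move=> a x y /asboolP hx /asboolP hy; apply/asboolP/smemL.
Qed.

HB.instance Definition _ :=
  GRing.isSubmodClosed.Build R M spred spred_closed.

Record submod_type := SubmodType {sval_ :> M; _ : sval_ \in spred}.

HB.instance Definition _ := [isSub for sval_].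
HB.instance Definition _ := [Choice of submod_type by <:].
HB.instance Definition _ := [SubChoice_isSubLmodule of submod_type by <:].

Definition smk x (hx : S x) : submod_type := SubmodType (asboolT hx).

Definition sincl : {linear submod_type -> M} := val.

Lemma sinclP (x : submod_type) : S (sincl x).
Proof. exact/asboolP/(valP x). Qed.

Lemma sincl_inj : injective sincl.
Proof. exact: val_inj. Qed.

Lemma sincl_smk x (hx : S x) : sincl (smk hx) = x.
Proof. by []. Qed.

Lemma corestr_linear (N : lmodType R) (f : {linear N -> M})
  (hf : forall x, S (f x)) : linear (fun x => smk (hf x)).
Proof. by move=> a x y; apply: val_inj; rewrite /= linearP. Qed.

Definition corestr (N : lmodType R) (f : {linear N -> M})
  (hf : forall x, S (f x)) := mkLin (corestr_linear hf).

Lemma corestrE (N : lmodType R) (f : {linear N -> M}) (hf : forall x, S (f x)) x :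
  sincl (corestr hf x) = f x.
Proof. by []. Qed.

End Submodule.

Section KerIm.
Variables (R : comPzRingType) (A B : lmodType R) (f : {linear A -> B}).

Definition kers : submod A.
Proof.
exists (fun x => f x = 0); first exact: linear0.
by move=> a x y hx hy; rewrite linearP hx hy scaler0 addr0.
Defined.

Definition ims : submod B.
Proof.
exists (fun y => exists x, f x = y); first by exists 0; exact: linear0.
by move=> a _ _ [x <-] [y <-]; exists (a *: x + y); rewrite linearP.
Defined.

End KerIm.

Section Quotient.
Variables (R : pzRingType) (M : lmodType R) (S : submod M).

Definition qequiv (x y : M) := `[< S (x - y) >].

Lemma qequiv_refl : reflexive qequiv.
Proof. by move=> x; apply/asboolP; rewrite subrr; exact: smem0. Qed.

Lemma qequiv_sym : symmetric qequiv.
Proof.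
by move=> x y; apply/asboolP/asboolP => h; rewrite -opprB; exact: smemN.
Qed.

Lemma qequiv_trans : transitive qequiv.
Proof.
move=> y x z /asboolP h /asboolP h'; apply/asboolP.
by rewrite -[x](subrK y) -addrA; exact: smemD.
Qed.

Canonical qequiv_equiv := EquivRel qequiv qequiv_refl qequiv_sym qequiv_trans.

Definition quotmod := {eq_quot qequiv}.

HB.instance Definition _ : EqQuotient _ qequiv quotmod :=
  EqQuotient.on quotmod.
HB.instance Definition _ := Choice.on quotmod.

Local Notation pi := (\pi_quotmod).

Lemma qpiP x y : S (x - y) <-> pi x = pi y.
Proof.
split=> [h|/eqmodP/asboolP//]; exact/eqmodP/asboolP.
Qed.

Lemma qrepr x : S (repr (pi x) - x).
Proof. by apply/qpiP; rewrite reprK. Qed.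

Definition qadd := lift_op2 quotmod (@GRing.add M).
Definition qopp := lift_op1 quotmod (@GRing.opp M).
Definition qscale (a : R) := lift_op1 quotmod (@GRing.scale R M a).

Lemma qrepr' x : S (x - repr (pi x)).
Proof. by rewrite -opprB; apply/smemN/qrepr. Qed.

Lemma pi_qadd : {morph pi : x y / x + y >-> qadd x y}.
Proof.
move=> x y; unlock qadd; apply/qpiP; rewrite opprD addrACA.
by apply: smemD; exact: qrepr'.
Qed.

Lemma pi_qopp : {morph pi : x / - x >-> qopp x}.
Proof.
by move=> x; unlock qopp; apply/qpiP; rewrite opprK addrC; exact: qrepr.
Qed.

Lemma pi_qscale a : {morph pi : x / a *: x >-> qscale a x}.
Proof.
move=> x; unlock qscale; apply/qpiP; rewrite -scalerBr.
exact/smemZ/qrepr'.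
Qed.

Lemma qaddA : associative qadd.
Proof.
by elim/quotW=> x; elim/quotW=> y; elim/quotW=> z; rewrite -!pi_qadd addrA.
Qed.
Lemma qaddC : commutative qadd.
Proof. by elim/quotW=> x; elim/quotW=> y; rewrite -!pi_qadd addrC. Qed.
Lemma qadd0 : left_id (pi 0) qadd.
Proof. by elim/quotW=> x; rewrite -pi_qadd add0r. Qed.
Lemma qaddN : left_inverse (pi 0) qopp qadd.
Proof. by elim/quotW=> x; rewrite -pi_qopp -pi_qadd addNr. Qed.

HB.instance Definition _ := GRing.isZmodule.Build quotmod
  qaddA qaddC qadd0 qaddN.

Lemma qscaleA a b x : qscale a (qscale b x) = qscale (a * b) x.
Proof. by elim/quotW: x => x; rewrite -!pi_qscale scalerA. Qed.
Lemma qscale1 : left_id 1 qscale.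
Proof. by elim/quotW=> x; rewrite -pi_qscale scale1r. Qed.
Lemma qscaleDr : right_distributive qscale +%R.
Proof.
move=> a; elim/quotW=> x; elim/quotW=> y.
by rewrite /GRing.add /= -!(pi_qadd, pi_qscale) scalerDr.
Qed.
Lemma qscaleDl x : {morph qscale^~ x : a b / a + b}.
Proof.
elim/quotW: x => x a b.
by rewrite [RHS]/GRing.add /= -!(pi_qadd, pi_qscale) scalerDl.
Qed.

HB.instance Definition _ := GRing.Zmodule_isLmodule.Build R quotmod
  qscaleA qscale1 qscaleDr qscaleDl.

Lemma qpi_linear : linear (pi : M -> quotmod).
Proof. by move=> a x y; rewrite pi_qadd pi_qscale. Qed.

Definition qpi : {linear M -> quotmod} := mkLin qpi_linear.

Lemma qpi_surj y : exists x, qpi x = y.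
Proof. by exists (repr y); exact: reprK. Qed.

Lemma qpi_eq0 x : qpi x = 0 <-> S x.
Proof. by rewrite -[X in S X]subr0 qpiP. Qed.

End Quotient.

Section FinSupp.
Variables (R : pzRingType) (I : choiceType) (V : lmodType R).

(** The bounding list need not be the exact support, so closure under sums is concatenation. *)
Definition finsupp_mod : submod (I -> V).
Proof.
exists (fun f => exists s : seq I, forall i, f i != 0 -> i \in s).
  by exists [::] => i; rewrite eqxx.
move=> a f g [s hs] [t ht]; exists (s ++ t) => i; apply: contraR.
rewrite mem_cat negb_or => /andP[/(contraNN (hs i)) /negPn/eqP hf].
move=> /(contraNN (ht i))/negPn/eqP hg.
by rewrite -[_ i]/(a *: f i + g i) hf hg scaler0 addr0.
Defined.

Definition fsupp := submod_type finsupp_mod.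
HB.instance Definition _ := GRing.Lmodule.on fsupp.

Definition coord (i : I) (x : fsupp) : V := sincl finsupp_mod x i.

Lemma coord_linear i : linear (coord i).
Proof. by move=> a x y; rewrite /coord linearP. Qed.

HB.instance Definition _ i :=
  GRing.isLinear.Build R fsupp V *:%R (coord i) (coord_linear i).

Lemma coordB i x y : coord i (x - y) = coord i x - coord i y.
Proof. exact: linearB. Qed.

Lemma coordZ i a x : coord i (a *: x) = a *: coord i x.
Proof. exact: linearZ_LR. Qed.

Lemma fsuppP (x y : fsupp) : (forall i, coord i x = coord i y) -> x = y.
Proof. by move=> h; apply: sincl_inj; apply/funext => i; exact: h. Qed.

Lemma supp_ex (x : fsupp) :
  exists s : seq I, uniq s /\ forall i, (i \in s) = (coord i x != 0).
Proof.
have [s hs] := sinclP x.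
exists (undup [seq i <- s | coord i x != 0]); split; first exact: undup_uniq.
move=> i; rewrite mem_undup mem_filter andbC.
by have [/hs ->//|h] := boolP (coord i x != 0); rewrite andbF.
Qed.

Definition supp x := sval (cid (supp_ex x)).

Lemma supp_uniq x : uniq (supp x).
Proof. by rewrite /supp; case: cid => s []. Qed.

Lemma mem_supp x i : (i \in supp x) = (coord i x != 0).
Proof. by rewrite /supp; case: cid => s []. Qed.

Lemma single_proof i (v : V) : finsupp_mod (fun j => if j == i then v else 0).
Proof.
by exists [:: i] => j; rewrite inE; case: (j == i) => //; rewrite eqxx.
Qed.

Definition single i v : fsupp := smk (single_proof i v).

Lemma coord_single i j v : coord j (single i v) = if j == i then v else 0.
Proof. by []. Qed.

Lemma single_linear i : linear (single i).
Proof.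
move=> a v w; apply: fsuppP => j; rewrite linearP /= !coord_single.
by case: ifP => // _; rewrite scaler0 addr0.
Qed.

HB.instance Definition _ i :=
  GRing.isLinear.Build R V fsupp *:%R (single i) (single_linear i).

Lemma fsupp_sum (x : fsupp) : x = \sum_(i <- supp x) single i (coord i x).
Proof.
apply: fsuppP => j; rewrite linear_sum /=.
under eq_bigr do rewrite coord_single.
have [jx|] := boolP (j \in supp x).
  rewrite (bigD1_seq j) ?supp_uniq //= eqxx big1 ?addr0 // => i.
  by rewrite eq_sym => /negPf ->.
move=> jx; rewrite big_seq big1 => [|i ix].
  by move: jx; rewrite mem_supp negbK => /eqP.
by case: eqP => // ji; rewrite -ji (negPf jx) in ix.
Qed.

End FinSupp.

(** * Free modules and linear extension from a basis *)

Section FreeModule.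
Variable R : comPzRingType.

Definition free_module (I : choiceType) := fsupp I R^o.
HB.instance Definition _ I := GRing.Lmodule.on (free_module I).

Definition delta (I : choiceType) (i : I) : free_module I := single i (1 : R^o).

Section LinExt.
Variables (I : choiceType) (M : lmodType R) (v : I -> M).

Definition linext_fun (x : free_module I) := \sum_(i <- supp x) coord i x *: v i.

(** The additional coefficients vanish. Linearity can thus be checked on one list containing all the
    supports involved. *)
Lemma linext_superset (x : free_module I) (s : seq I) : uniq s ->
  {subset supp x <= s} -> linext_fun x = \sum_(i <- s) coord i x *: v i.
Proof.
move=> us hs; rewrite (bigID (mem (supp x))) /= [X in _ + X]big1 ?addr0.
  rewrite -big_filter; apply: perm_big; apply: uniq_perm.
  - exact: supp_uniq.
  - exact: filter_uniq.
  by move=> i; rewrite mem_filter; case: (boolP (i \in supp x)) => // /hs ->.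
by move=> i; rewrite mem_supp negbK => /eqP ->; rewrite scale0r.
Qed.

Lemma linext_linear : linear linext_fun.
Proof.
move=> a x y; pose s := undup (supp x ++ supp y ++ supp (a *: x + y)).
have us : uniq s by exact: undup_uniq.
rewrite !(@linext_superset _ s) //; last first.
- by move=> i h; rewrite mem_undup !mem_cat h ?orbT.
- by move=> i h; rewrite mem_undup !mem_cat h ?orbT.
- by move=> i h; rewrite mem_undup !mem_cat h ?orbT.
rewrite scaler_sumr -big_split /=; apply: eq_bigr => i _.
by rewrite linearP scalerDl scalerA.
Qed.

Definition linext : {linear free_module I -> M} := mkLin linext_linear.

Lemma linextE x : linext x = \sum_(i <- supp x) coord i x *: v i.
Proof. by []. Qed.

Lemma linext_delta i : linext (delta i) = v i.
Proof.
rewrite /= (@linext_superset _ [:: i]) //.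
  by rewrite big_seq1 /delta coord_single eqxx scale1r.
move=> j; rewrite mem_supp coord_single inE.
by case: (j == i) => //; rewrite eqxx.
Qed.

End LinExt.

Lemma free_sum (I : choiceType) (x : free_module I) :
  x = \sum_(i <- supp x) coord i x *: delta i.
Proof.
rewrite {1}[x]fsupp_sum; apply: eq_bigr => i _.
apply: fsuppP => j; rewrite linearZ /= !coord_single.
by case: eqP => _; rewrite ?scaler0 // /GRing.scale /= mulr1.
Qed.

Lemma free_ext (I : choiceType) (M : lmodType R) (f g : {linear free_module I -> M}) :
  (forall i, f (delta i) = g (delta i)) -> forall x, f x = g x.
Proof.
move=> h x; rewrite (free_sum x) !linear_sum; apply: eq_bigr => i _.
by rewrite !linearZ h.
Qed.

Lemma free_projective (I : choiceType) : projective (free_module I).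
Proof.
move=> A B g f gsurj; have /choice[s hs] := gsurj.
exists (linext (fun i => s (f (delta i)))) => x.
apply: (free_ext (f := g \o linext _)) => i /=.
by rewrite -[linext_fun _ _]/(linext _ _) linext_delta hs.
Qed.

(** The free module on the underlying set of [P] maps onto [P], and projectivity splits this map. *)
Lemma projective_retract (P : lmodType R) : projective P ->
  exists (i : {linear P -> free_module P}) (p : {linear free_module P -> P}),
    forall x, p (i x) = x.
Proof.
move=> hP; pose p : {linear free_module P -> P} := linext id.
have [|i hi] := hP _ _ p (idfun : {linear P -> P}).
  by move=> x; exists (delta x); rewrite linext_delta.
by exists i, p.
Qed.

End FreeModule.

(** * Noetherian rings and their total rings of fractions *)

Lemma lregP (R : comPzRingType) (u : R) :
  GRing.lreg u <-> forall x, u * x = 0 -> x = 0.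
Proof.
split=> [h x ux|h x y /eqP]; first by apply: h; rewrite ux mulr0.
by rewrite -subr_eq0 -mulrBr => /eqP/h/eqP; rewrite subr_eq0 => /eqP.
Qed.

Lemma nlregP (R : comPzRingType) (u : R) :
  ~ GRing.lreg u -> exists2 x, u * x = 0 & x <> 0.
Proof.
move=> h; apply: contrapT => h'; apply/h/lregP => x ux.
by apply: contrapT => hx; apply: h'; exists x.
Qed.

(** * Associated and minimal primes of a noetherian ring *)

Section NoetherianRing.
Variable R : comPzRingType.
Hypothesis noethR : noetherian R.
Implicit Types (I p : set R) (x y : R).

(** Without a maximal member, choice would produce a strictly ascending chain. *)
Lemma noetherian_max (F : set (set R)) : (forall I, F I -> ideal I) ->
  (exists I, F I) -> exists I, F I /\ forall J, F J -> I `<=` J -> J `<=` I.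
Proof.
move=> Fid [I0 FI0]; apply: contrapT => hn.
have step (I : {I | F I}) : exists J : {I | F I},
    sval I `<=` sval J /\ ~ sval J `<=` sval I.
  apply: contrapT => h; apply: hn; exists (sval I); split=> [|J FJ IJ].
    exact: (svalP I).
  by apply: contrapT => JI; apply: h; exists (exist _ J FJ).
have [g hg] := choice step.
pose s n := iter n g (exist _ I0 FI0).
have [m hm] : exists m, forall n, (m <= n)%N -> sval (s n) = sval (s m).
  apply: noethR => n; first exact/Fid/(svalP (s n)).
  exact: (hg (s n)).1.
by have := (hg (s m)).2; apply; rewrite -[g _]/(s m.+1) hm.
Qed.

Lemma ideal_ann x : ideal [set a | a * x = 0].
Proof.
split=> /= [|a b ha hb|r a ha]; first by rewrite mul0r.
- by rewrite mulrDl ha hb addr0.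
- by rewrite -mulrA ha mulr0.
Qed.

Lemma ideal_sub I a b : ideal I -> I a -> I b -> I (a - b).
Proof.
by case=> _ hD hM ha hb; apply: hD => //; rewrite -mulN1r; exact: hM.
Qed.

Lemma ideal_adjoin I x : ideal I ->
  ideal [set a | exists2 r, I r & exists q, a = r + q * x].
Proof.
move=> [h0 hD hM]; split=> /=.
- by exists 0 => //; exists 0; rewrite mul0r addr0.
- move=> _ _ [r hr [q ->]] [r' hr' [q' ->]]; exists (r + r'); first exact: hD.
  by exists (q + q'); ring.
- move=> a _ [r hr [q ->]]; exists (a * r); first exact: hM.
  by exists (a * q); ring.
Qed.

(** If neither a nor b is in p, then p + Ra and p + Rb both meet S. The product of two such elements
    is in S, and in p when ab is. *)
Lemma ideal_prime_exclusion p (S : R -> Prop) : ideal p ->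
  (forall a b, S a -> S b -> S (a * b)) -> S 1 -> (forall a, p a -> ~ S a) ->
  (forall J, ideal J -> (forall a, J a -> ~ S a) -> p `<=` J -> J `<=` p) ->
  prime_ideal p.
Proof.
move=> hp SM S1 pS pmax; split=> [//|/pS//|a b pab].
apply: contrapT => /not_orP[na nb].
have hit x : ~ p x -> exists2 r, p r & exists q, S (r + q * x).
  move=> nx; apply: contrapT => h; apply: nx.
  apply: (pmax _ (ideal_adjoin x hp)).
  - by move=> _ [r pr [q ->]] Sa; apply: h; exists r => //; exists q.
  - by move=> r pr; exists r => //; exists 0; rewrite mul0r addr0.
  - by exists 0; [case: hp | exists 1; rewrite add0r mul1r].
have [r pr [q Sq]] := hit a na; have [r' pr' [q' Sq']] := hit b nb.
apply: (pS _ _ (SM _ _ Sq Sq')).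
have -> : (r + q * a) * (r' + q' * b)
  = (r' + q' * b) * r + (q * a * r' + q * q' * (a * b)) by ring.
by case: hp => _ hD hM; apply: (hD); [|apply: (hD)]; apply: hM.
Qed.

(** The annihilators of these elements are the maximal associated primes; the elements are carried
    instead of the primes. *)
Definition max_ann x := x <> 0 /\
  forall y, y <> 0 -> (forall a, a * x = 0 -> a * y = 0) ->
    forall a, a * y = 0 -> a * x = 0.

Lemma max_ann_exists x : x <> 0 ->
  exists y, max_ann y /\ forall a, a * x = 0 -> a * y = 0.
Proof.
move=> x0; pose F : set (set R) := [set I | exists2 y, y <> 0 &
  (forall a, a * x = 0 -> a * y = 0) /\ I = [set a | a * y = 0]].
have [||_ [[y y0 [xy ->]] ymax]] := @noetherian_max F.
- by move=> _ [y _ [_ ->]]; exact: ideal_ann.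
- by exists [set a | a * x = 0], x.
exists y; split=> //; split=> // z z0 yz a.
by apply: (ymax [set a | a * z = 0]) => //; exists z => //; split => // b /xy/yz.
Qed.

(** If by is nonzero, its annihilator contains that of y, hence equals it by maximality. *)
Lemma max_ann_prime y : max_ann y -> prime_ideal [set a | a * y = 0].
Proof.
move=> [y0 ymax]; split=> [|/=|a b /= aby]; first exact: ideal_ann.
- by rewrite mul1r.
- have [by0|by0] := EM (b * y = 0); [by right | left].
  apply: (ymax (b * y)) => // [c cy|]; last by rewrite mulrA.
  by rewrite mulrCA cy mulr0.
Qed.

Lemma associated_prime_exists x : x <> 0 ->
  exists p, associated_primes R p /\ [set a | a * x = 0] `<=` p.
Proof.
move=> /max_ann_exists[y [my xy]]; exists [set a | a * y = 0]; split => //.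
by split; [exact: max_ann_prime | exists y].
Qed.

(* The list s is chosen with the largest double annihilator: then that of every
   max_ann element y contains the annihilator of s, hence that of a member. *)
Lemma finite_max_ann : exists s : seq R,
  (forall y, y \in s -> max_ann y) /\
  forall a, ~ GRing.lreg a -> exists2 y, y \in s & a * y = 0.
Proof.
pose F : set (set R) := [set I | exists2 s : seq R,
  (forall y, y \in s -> max_ann y) & I = [set z | forall a,
   (forall y, y \in s -> a * y = 0) -> a * z = 0]].
have [||_ [[s hs ->] smax]] := @noetherian_max F.
- move=> _ [s _ ->]; split=> /= [a _|a b ha hb c hc|r a ha c hc].
  + by rewrite mulr0.
  + by rewrite mulrDr ha // hb // addr0.
  + by rewrite mulrCA ha // mulr0.
- by eexists; exists [::].
exists s; split=> // a /nlregP[x ax /max_ann_exists[y [my xy]]].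
have ay := xy _ ax.
have sy b : (forall z, z \in s -> b * z = 0) -> b * y = 0.
  move: b; apply: (smax [set z | forall a,
    (forall t, t \in y :: s -> a * t = 0) -> a * z = 0]).
  - exists (y :: s) => // t; rewrite inE => /predU1P[->//|]; exact: hs.
  - by move=> t /= st b hb; apply: st => z zs; apply: hb; rewrite inE zs orbT.
  - by move=> b; apply; rewrite mem_head.
have [ip n1 pr] := max_ann_prime my.
(* The prime ann y contains the intersection of the ann z, hence one of them: otherwise a product of
   elements of the ann z, each outside ann y, kills [s] but not y. *)
suff [z zs zy] : exists2 z, z \in s & forall a, a * z = 0 -> a * y = 0.
  exists z => //; have [_ zmax] := hs z zs.
  exact: zmax my.1 zy a ay.
apply: contrapT => hn.
have hb z : z \in s -> exists2 b, b * z = 0 & b * y <> 0.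
  move=> zs; apply: contrapT => h; apply: hn; exists z => // b bz.
  by apply: contrapT => by0; apply: h; exists b.
suff [b sb /(_ (sy b sb))//] : exists2 b,
    (forall z, z \in s -> b * z = 0) & (b * y <> 0).
elim: (s) hb => [|z t IH] hb; first by exists 1; rewrite ?mul1r //; exact: my.1.
have [b bt by0] : exists2 b, (forall z, z \in t -> b * z = 0) & (b * y <> 0).
  by apply: IH => u ut; apply: hb; rewrite inE ut orbT.
have [c cz cy0] := hb z (mem_head _ _).
exists (b * c) => [u|/pr[]//].
rewrite inE => /predU1P[->|ut]; first by rewrite -mulrA cz mulr0.
by rewrite mulrAC bt // mul0r.
Qed.

(** Induction on the list: if a misses the annihilators over [s] but kills y, an element of I that
    kills [s] and not y is added to it. *)
Lemma prime_avoidance I (s : seq R) : ideal I ->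
  (forall y, y \in s -> max_ann y /\ exists2 a, I a & a * y <> 0) ->
  exists2 a, I a & forall y, y \in s -> a * y <> 0.
Proof.
move=> idI; have [I0 ID IM] := idI.
elim: s => [_|y s IH hs]; first by exists 0.
have [|a Ia sa] := IH.
  by move=> z zs; apply: hs; rewrite inE zs orbT.
have [ay|ay] := EM (a * y = 0); last first.
  by exists a => // z; rewrite inE => /predU1P[->|/sa].
have [my [b0 Ib0 b0y]] := hs y (mem_head _ _).
have [_ _ pr] := max_ann_prime my.
have [b Ib [sb by0]] : exists2 b, I b &
    (forall z, z \in s -> b * z = 0) /\ b * y <> 0.
  have : {subset s <= s} by [].
  elim: {1 3}s => [|z t IHt] ts; first by exists b0.
  have [|b Ib [tb by0]] := IHt.
    by move=> u ut; apply: ts; rewrite inE ut orbT.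
  have zs : z \in s by apply: ts; exact: mem_head.
  (* As a kills y and not z, maximality at z forbids that ann z be contained in ann y. *)
  have [c cz cy] : exists2 c, c * z = 0 & c * y <> 0.
    apply: contrapT => h; apply: (sa z zs).
    have [mz _] := hs z (mem_behead (s := y :: s) zs).
    apply: (mz.2 y my.1 _ _ ay) => c cz.
    by apply: contrapT => cy; apply: h; exists c.
  exists (c * b); first exact: IM.
  split=> [u|/pr[]//].
  rewrite inE => /predU1P[->|ut]; first by rewrite mulrAC cz mul0r.
  by rewrite -mulrA tb // mulr0.
exists (a + b); first exact: ID.
move=> z; rewrite inE mulrDl => /predU1P[->|zs]; first by rewrite ay add0r.
by rewrite sb // addr0; exact: sa.
Qed.

(** Finitely many annihilators cover the zero divisors, so by prime avoidance I lies in one of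
    them. *)
Lemma zero_divisor_ideal I : ideal I -> (forall a, I a -> ~ GRing.lreg a) ->
  exists2 x, x <> 0 & forall a, I a -> a * x = 0.
Proof.
move=> idI hI; have [s [ms free_cover]] := finite_max_ann.
apply: contrapT => h.
have [|a Ia sa] := @prime_avoidance I s idI.
  move=> y ys; split; first exact: ms.
  apply: contrapT => h'; apply: h; exists y; first exact: (ms y ys).1.
  by move=> a Ia; apply: contrapT => ay; apply: h'; exists a.
by have [y ys /(sa y ys)] := free_cover a (hI a Ia).
Qed.

(** This is nilpotency of s in the localization at p. Otherwise 0 is not of the form s^n t with t
    outside p, and an ideal maximal among those missing all such elements is a prime inside p
    without s. *)
Lemma minimal_prime_nilp p s : minimal_primes R p -> p s ->
  exists n t, ~ p t /\ s ^+ n * t = 0.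
Proof.
move=> [[idp p1 pM] pmin] ps; apply: contrapT => h.
pose S a := exists n t, ~ p t /\ a = s ^+ n * t.
have SM a b : S a -> S b -> S (a * b).
  move=> [n [t [pt ->]]] [m [u [pu ->]]]; exists (n + m)%N, (t * u).
  by split; [case/pM | rewrite exprD; ring].
have S1 : S 1 by exists 0%N, 1; rewrite expr0 mulr1.
pose F : set (set R) := [set J | ideal J /\ forall a, J a -> ~ S a].
have [||q [[idq qS] qmax]] := @noetherian_max F.
- by move=> J [].
- exists [set 0]; split.
    by split=> /= [//|a b -> ->|r a ->]; rewrite ?addr0 ?mulr0.
  by move=> _ -> [n [t [pt /esym st]]]; apply: h; exists n, t.
have pq : prime_ideal q.
  by apply: (ideal_prime_exclusion idq SM S1 qS) => J idJ JS; exact: qmax.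
have qp : q `<=` p.
  move=> a qa; apply: contrapT => pa; apply: (qS a qa).
  by exists 0%N, a; rewrite expr0 mul1r.
apply: (qS s); first by rewrite (pmin q pq qp).
by exists 1%N, 1; rewrite expr1 mulr1.
Qed.

(* The localization at the non zero divisors is strongly pi-regular; for a
   noetherian ring this says that it has Krull dimension 0. *)
Definition pi_regular_fractions := forall s : R, exists n (u r : R),
  GRing.lreg u /\ u * s ^+ n = s ^+ n.+1 * r.

(** As s^n (u - s r) = 0, either s or u - s r is in p. In the second case u x = 0 because s x = 0,
    against the regularity of u. *)
Lemma pi_regular_prime p s x : pi_regular_fractions -> prime_ideal p ->
  (forall a, p a -> a * x = 0) -> x <> 0 -> s * x = 0 -> p s.
Proof.
move=> hpi [idp p1 pM] px x0 sx.
have [n [u [r [/lregP ur usr]]]] := hpi s.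
have : p (s ^+ n * (u - s * r)).
  have -> : s ^+ n * (u - s * r) = u * s ^+ n - s ^+ n.+1 * r.
    by rewrite exprSr; ring.
  by rewrite usr subrr; case: idp.
case/pM=> [|/px/eqP].
  elim: n {usr} => [|n IH]; first by rewrite expr0.
  by rewrite exprS => /pM[].
rewrite mulrBl (mulrC s) -(mulrA r) sx mulr0 subr0 => /eqP/ur//.
Qed.

Lemma associated_prime_minimal p : pi_regular_fractions ->
  associated_primes R p -> minimal_primes R p.
Proof.
move=> hpi [pp [x ep]]; split=> // q pq qp; apply/seteqP; split=> // s ps.
have px a : p a -> a * x = 0 by rewrite ep.
apply: (@pi_regular_prime q s x) => //; last exact: px.
- by move=> a /qp/px.
- by move=> x0; case: pp => _ p1 _; apply: p1; rewrite ep /= x0 mulr0.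
Qed.

(** A minimal prime consists of zero divisors, as its elements are nilpotent in the localization. So
    it lies in an associated prime, which is itself minimal. *)
Lemma associated_primesE : pi_regular_fractions ->
  associated_primes R = minimal_primes R.
Proof.
move=> hpi; apply/seteqP; split=> p; first exact: associated_prime_minimal.
move=> mp; have [[idp p1 pM] pmin] := mp.
have [|x x0 px] := zero_divisor_ideal idp.
  move=> s ps /lregP sreg; have [n [t [pt st]]] := minimal_prime_nilp mp ps.
  apply: pt; suff -> : t = 0 by case: idp.
  elim: n st => [|n IH]; first by rewrite expr0 mul1r.
  by rewrite exprS -mulrA => /sreg.
have [q [aq xq]] := associated_prime_exists x0.
have [pq qmin] := associated_prime_minimal hpi aq.
by rewrite (qmin p mp.1) // => a /px/xq.
Qed.

Lemma ann_exp_stable (s : R) :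
  exists n, forall k t, s ^+ k * t = 0 -> s ^+ n * t = 0.
Proof.
have [||m hm] := noethR (I := fun n => [set t | s ^+ n * t = 0]).
- move=> n; have := ideal_ann (s ^+ n); congr ideal.
  by apply/seteqP; split=> t /=; rewrite mulrC.
- by move=> n t /= h; rewrite exprS -mulrA h mulr0.
exists m => k t kt; have : [set t | s ^+ (m + k) * t = 0] t.
  by rewrite /= exprD -mulrA kt mulr0.
by rewrite (hm _ (leq_addr _ _)).
Qed.

(** Take n where the annihilators of the s^n stabilize. If I has no non zero divisor, it lies in an
    associated, hence minimal, prime p. Since s is in I, some t outside p satisfies s^n t = 0, so t
    is in I. *)
Lemma pi_regular_of_associated : associated_primes R = minimal_primes R ->
  pi_regular_fractions.
Proof.
move=> hA s; have [n hn] := ann_exp_stable s.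
pose I : set R := [set u | exists r, u * s ^+ n = s ^+ n.+1 * r].
have idI : ideal I.
  split=> /= [|a b [r hr] [r' hr']|a b [r hr]].
  - by exists 0; rewrite mul0r mulr0.
  - by exists (r + r'); rewrite mulrDl mulrDr hr hr'.
  - by exists (a * r); rewrite -mulrA hr mulrCA.
apply: contrapT => h.
have [|x x0 Ix] := zero_divisor_ideal idI.
  by move=> u [r hr] ureg; apply: h; exists n, u, r.
have [p [ap xp]] := associated_prime_exists x0.
have mp : minimal_primes R p by rewrite -hA.
have ps : p s by apply/xp/Ix; exists 1; rewrite exprS mulr1.
have [k [t [pt kt]]] := minimal_prime_nilp mp ps.
by apply/pt/xp/Ix; exists 0; rewrite mulr0 mulrC; exact: hn kt.
Qed.

(* An ideal I maximal such that the descending chains above I need not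
   stabilize would be prime, hence maximal. *)
Lemma noetherian_pi_regular_artinian :
  (forall s : R, exists n r, s ^+ n = s ^+ n.+1 * r) -> artinian R.
Proof.
move=> hpi; pose dcc_above I := forall C : nat -> set R, (forall n, ideal (C n)) ->
    (forall n, C n.+1 `<=` C n) -> (forall n, I `<=` C n) ->
    exists m, forall n, (m <= n)%N -> C n = C m.
pose F : set (set R) := [set I | ideal I /\ ~ dcc_above I].
have [h|/existsNP[C]] := EM (forall C : nat -> set R, (forall n, ideal (C n)) ->
    (forall n, C n.+1 `<=` C n) ->
    exists m, forall n, (m <= n)%N -> C n = C m); first exact: h.
move=> /not_implyP[idC /not_implyP[decC nC]]; exfalso.
have [||I [[idI nI] Imax]] := @noetherian_max F.
- by move=> I [].
- exists [set 0]; split.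
    by split=> /= [//|a b -> ->|r a ->]; rewrite ?addr0 ?mulr0.
  by move/(_ C idC decC) => h; apply/nC/h => n _ ->; case: (idC n).
have big J : ideal J -> I `<=` J -> ~ J `<=` I -> dcc_above J.
  by move=> idJ IJ nJ; apply: contrapT => h; apply/nJ/Imax.
have dec (D : nat -> set R) : (forall n, D n.+1 `<=` D n) ->
    forall n k, (n <= k)%N -> D k `<=` D n.
  move=> decD n k /subnKC <-; elim: (k - n)%N => [|j IH]; first by rewrite addn0.
  by rewrite addnS => x /decD/IH.
have pI : prime_ideal I.
  split=> // [I1|a b Iab].
    apply: nI => D idD _ ID; exists 0%N => n _.
    have DT k x : D k x.
      by rewrite -[x]mulr1; case: (idD k) => _ _ h; exact/h/ID.
    by apply/seteqP; split=> x _; exact: DT.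
  apply: contrapT => /not_orP[Ia Ib]; have [I0 ID IM] := idI.
  apply: nI => D idD decD ID'.
  (* In a descending chain, D n is determined by D n + Ra and (D n : a). These chains lie above I +
     Ra and (I : a), both larger than I: the latter contains b. *)
  pose add (K : set R) := [set c | exists2 r, K r & exists q, c = r + q * a].
  pose col (K : set R) := [set q | K (q * a)].
  have idcol K : ideal K -> ideal (col K).
    move=> [K0 KD KM]; split=> /= [|x y hx hy|r x hx]; rewrite /col /=.
    - by rewrite mul0r.
    - by rewrite mulrDl; exact: KD.
    - by rewrite -mulrA; exact: KM.
  have [|||||m1 hm1] := @big (add I) (ideal_adjoin a idI) _ _ (fun n => add (D n)).
  - by move=> r Ir; exists r => //; exists 0; rewrite mul0r addr0.
  - by move/(_ a) => h; apply/Ia/h; exists 0 => //; exists 1; rewrite add0r mul1r.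
  - by move=> n; exact: ideal_adjoin.
  - by move=> n c [r /decD Dr hq]; exists r.
  - by move=> n c [r /ID' Dr hq]; exists r.
  have [|||||m2 hm2] := @big (col I) (idcol _ idI) _ _ (fun n => col (D n)).
  - by move=> r Ir; rewrite /col /= mulrC; exact: IM.
  - by move/(_ b) => h; apply/Ib/h; rewrite /col /= mulrC.
  - by move=> n; exact: idcol.
  - by move=> n q; exact: decD.
  - by move=> n q; exact: ID'.
  exists (maxn m1 m2) => n; rewrite geq_max => /andP[n1 n2].
  pose m := maxn m1 m2.
  have e1 : add (D n) = add (D m) by rewrite (hm1 n) // (hm1 m) // leq_maxl.
  have e2 : col (D n) = col (D m) by rewrite (hm2 n) // (hm2 m) // leq_maxr.
  have nm : (m <= n)%N by rewrite geq_max n1 n2.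
  apply/seteqP; split; first exact: dec.
  move=> x Dx; have : add (D m) x.
    by exists x => //; exists 0; rewrite mul0r addr0.
  rewrite -e1 => -[r Dr [q xq]]; rewrite xq.
  have [_ hD _] := idD n; apply: (hD _ _ Dr).
  suff : col (D m) q by rewrite -e2.
  have -> : col (D m) q = D m (x - r) by rewrite xq addrC addKr.
  exact: (ideal_sub (idD m) Dx (dec _ decD _ _ nm _ Dr)).
have [_ nI1 pM] := pI.
(* I is a maximal ideal: for s outside I, s^n (1 - s r) = 0 puts 1 - s r in I. *)
have maxI D s : ideal D -> I `<=` D -> D s -> ~ I s -> D = setT.
  move=> [D0 hD hM] ID Ds Is; have [n [r sn]] := hpi s.
  have : I (s ^+ n * (1 - s * r)).
    have -> : s ^+ n * (1 - s * r) = s ^+ n - s ^+ n.+1 * r.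
      by rewrite exprSr; ring.
    by rewrite -sn subrr; case: idI.
  case/pM=> [Isn|/ID D1].
    exfalso; apply: Is; elim: n Isn {sn} => [|n IH]; first by rewrite expr0.
    by rewrite exprS => /pM[].
  apply/seteqP; split=> // x _; rewrite -[x]mulr1; apply: (hM).
  by rewrite -[1](subrK (s * r)); apply: hD => //; rewrite mulrC; exact: hM.
apply: nI => D idD decD ID.
have [[n Dn]|h] := EM (exists n, D n `<=` I).
  exists n => k nk; apply/seteqP; split; first exact: dec.
  by move=> x /Dn/ID.
have DT n : D n = setT.
  apply: contrapT => nDT; apply: h; exists n => s Ds.
  by apply: contrapT => Is; apply/nDT/(maxI _ s).
by exists 0%N => n _; rewrite !DT.
Qed.

End NoetherianRing.

Lemma artinian_pi_regular (R : comPzRingType) : artinian R ->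
  forall s : R, exists n r, s ^+ n = s ^+ n.+1 * r.
Proof.
move=> hA s; have [n|n|m hm] := hA (fun n => [set a | exists r, a = s ^+ n * r]).
- split=> /= [|_ _ [r ->] [r' ->]|a _ [r ->]].
  + by exists 0; rewrite mulr0.
  + by exists (r + r'); rewrite mulrDr.
  + by exists (a * r); rewrite mulrCA.
- by move=> _ [r ->]; exists (s * r); rewrite exprSr mulrA.
have /= := hm m.+1 (leqnSn m) => /seteqP[_ /(_ (s ^+ m))] [].
  by exists 1; rewrite mulr1.
by move=> r hr; exists m, r.
Qed.

(** * Transfer between a ring and its total ring of fractions *)

Section TotalFractions.
Variable R : comPzRingType.
Local Notation Q := (total_fractions R).
Local Notation "a %:F" := (to_total_fractions a).

(** An ideal of Q is determined by its contraction to R, as a fraction and its numerator differ by a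
    unit. *)
Lemma noetherian_total_fractions : noetherian R -> noetherian Q.
Proof.
move=> hR I idI incI.
have [n|n|m hm] := hR (fun n => [set a | I n a%:F]).
- have [h0 hD hM] := idI n; split=> /= [|a b ha hb|r a ha].
  + by rewrite rmorph0.
  + by rewrite rmorphD; exact: hD.
  + by rewrite rmorphM; exact: hM.
- by move=> a; exact: incI.
exists m => n mn; have ext k q a s : q * s%:F = a%:F -> GRing.lreg s ->
    I k q <-> I k a%:F.
  have [_ _ hM] := idI k.
  move=> e /to_total_fractions_unit[t ts]; split; first by rewrite -e mulrC; exact: hM.
  by move/(hM t); rewrite -e mulrCA ts mulr1.
apply/seteqP; split=> q; have [a [s [sreg e]]] := total_fractionsP q.
- move/(ext _ _ _ _ e sreg) => h; apply/(ext _ _ _ _ e sreg).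
  by have /seteqP[+ _] := hm n mn; exact.
- move/(ext _ _ _ _ e sreg) => h; apply/(ext _ _ _ _ e sreg).
  by have /seteqP[_ +] := hm n mn; exact.
Qed.

(** The numerator of a non zero divisor is again a non zero divisor, hence becomes invertible. *)
Lemma total_fractions_lreg_unit (q : Q) : GRing.lreg q -> exists t, t * q = 1.
Proof.
move=> /lregP qreg; have [a [s [sreg e]]] := total_fractionsP q.
have [t ts] := to_total_fractions_unit sreg.
have areg : GRing.lreg a.
  apply/lregP => x ax; apply: to_total_fractions_inj; rewrite rmorph0.
  apply: qreg; have -> : q = t * a%:F by rewrite -e mulrCA ts mulr1.
  by rewrite -mulrA -rmorphM ax rmorph0 mulr0.
have [b ba] := to_total_fractions_unit areg.
by exists (b * s%:F); rewrite -ba -e; ring.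
Qed.

Lemma pi_regular_total_fractions :
  pi_regular_fractions R -> forall q : Q, exists n r, q ^+ n = q ^+ n.+1 * r.
Proof.
move=> hpi q; have [a [s [sreg e]]] := total_fractionsP q.
have [t ts] := to_total_fractions_unit sreg.
have [n [u [r [ureg ur]]]] := hpi a.
have [v vu] := to_total_fractions_unit ureg.
exists n, (s%:F * v * r%:F).
have -> : q = t * a%:F by rewrite -e mulrCA ts mulr1.
rewrite !exprMn; have -> : a%:F ^+ n = v * (a%:F ^+ n.+1 * r%:F).
  by rewrite -!rmorphXn -rmorphM -ur rmorphM mulrA vu mul1r.
rewrite [t ^+ n.+1]exprSr.
transitivity (t ^+ n * (t * s%:F) * (v * (a%:F ^+ n.+1 * r%:F))).
  by rewrite ts mulr1.
by ring.
Qed.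

Lemma pi_regular_of_total_fractions :
  (forall s : R, exists n r, s%:F ^+ n = s%:F ^+ n.+1 * r) ->
  pi_regular_fractions R.
Proof.
move=> hpi s; have [n [q e]] := hpi s.
have [a [u [ureg qu]]] := total_fractionsP q.
exists n, u, a; split=> //; apply: to_total_fractions_inj.
by rewrite !rmorphM !rmorphXn /= e -qu; ring.
Qed.

End TotalFractions.

(** * Vanishing of Ext through a short projective presentation *)

Section Lifting.
Variable R : comPzRingType.
Implicit Types A B P : lmodType R.

Lemma lin0_linear A B : linear (fun _ : A => 0 : B).
Proof. by move=> a x y; rewrite scaler0 addr0. Qed.

Definition lin0 A B : {linear A -> B} := mkLin (@lin0_linear A B).

(** Projectivity is applied after corestricting both maps to the image of g. *)
Lemma proj_lift P A B (g : {linear A -> B}) (f : {linear P -> B}) :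
  projective P -> (forall x, exists a, g a = f x) ->
  exists h : {linear P -> A}, forall x, g (h x) = f x.
Proof.
move=> hP fg; have gg a : ims g (g a) by exists a.
have [|h hh] := hP A (submod_type (ims g)) (corestr gg) (corestr (S := ims g) fg).
  move=> b; have [a ga] := sinclP b; exists a.
  by apply: sincl_inj; rewrite corestrE.
exists h => x; have := congr1 (sincl (ims g)) (hh x).
by rewrite !corestrE.
Qed.

Lemma retract_projective P A (i : {linear P -> A}) (p : {linear A -> P}) :
  (forall x, p (i x) = x) -> projective A -> projective P.
Proof.
move=> pi hA B C g f gsurj; have [h hh] := hA B C g (f \o p) gsurj.
by exists (h \o i) => x /=; rewrite hh /= pi.
Qed.

Lemma zero_projective : projective 'rV[R]_0.
Proof.
move=> A B g f _; exists (lin0 _ A) => x.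
by rewrite linear0 (thinmx0 x) linear0.
Qed.

Lemma inj_eq0 A B (d : {linear A -> B}) : injective d ->
  forall x, d x = 0 -> x = 0.
Proof. by move=> dinj x dx; apply: dinj; rewrite linear0. Qed.

Lemma eq0_inj A B (d : {linear A -> B}) :
  (forall x, d x = 0 -> x = 0) -> injective d.
Proof.
by move=> h x y /eqP; rewrite -subr_eq0 -linearB => /eqP/h/eqP; rewrite subr_eq0 => /eqP.
Qed.

End Lifting.

Section LengthOne.
Variables (R : comPzRingType) (M P1 P0 : lmodType R).
Variables (d : {linear P1 -> P0}) (a : {linear P0 -> M}).
Hypotheses (hP1 : projective P1) (hP0 : projective P0) (dinj : injective d).
Hypothesis asurj : forall x, exists y, a y = x.
Hypothesis aker : forall y, a y = 0 <-> exists z, d z = y.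

(** Row vectors of length 0 serve as the zero module. *)
Definition short_mod n : lmodType R :=
  match n with 0 => P0 | 1 => P1 | _ => 'rV[R]_0 end.

Definition short_diff n : {linear short_mod n.+1 -> short_mod n} :=
  match n return {linear short_mod n.+1 -> short_mod n} with
  | 0 => d | _ => lin0 _ _ end.

Lemma short_proj n : projective (short_mod n).
Proof. by case: n => [|[|n]] //=; exact: zero_projective. Qed.

Lemma short_exact n y :
  short_diff n y = 0 <-> exists z, short_diff n.+1 z = y.
Proof.
case: n y => [|n] y /=; last first.
  by split=> // _; exists 0; rewrite [y]thinmx0.
by split=> [/(inj_eq0 dinj)->|[_ <-]]; [exists 0 | exact: linear0].
Qed.

Definition short_res : proj_resolution M :=
  ProjResolution short_proj asurj aker short_exact.

Lemma short_pdim_le1 : pdim_le M 1.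
Proof. by exists short_res => -[|[|k]] //= _ x; exact: thinmx0. Qed.

End LengthOne.

(** For d an injection of projectives, this expresses that Ext^1 of the cokernel of d with values in
    Y vanishes. *)
Definition ext_along (R : comPzRingType) (P1 P0 Y : lmodType R)
  (d : {linear P1 -> P0}) := forall f : {linear P1 -> Y},
  exists g : {linear P0 -> Y}, forall x, g (d x) = f x.

Section Comparison.
Variables (R : comPzRingType) (M P1 P0 : lmodType R).
Variables (d : {linear P1 -> P0}) (a : {linear P0 -> M}).
Hypotheses (hP1 : projective P1) (hP0 : projective P0) (dinj : injective d).
Hypothesis asurj : forall x, exists y, a y = x.
Hypothesis aker : forall y, a y = 0 <-> exists z, d z = y.

Lemma presentation_homotopy (Q0 : lmodType R) (A : {linear Q0 -> M}) :
  projective Q0 -> (forall x, exists y, A y = x) ->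
  exists (al : {linear Q0 -> P0}) (be : {linear P0 -> Q0}),
    [/\ forall x, a (al x) = A x, forall x, A (be x) = a x &
     forall x, A (x - be (al x)) = 0].
Proof.
move=> hQ Asurj; have [al hal] := hQ _ _ a A asurj.
have [be hbe] := @hP0 _ _ A a Asurj; exists al, be; split=> // x.
by rewrite linearB /= hbe hal subrr.
Qed.

(** Schanuel's argument: the identity of K is [h0 i + be1 al1], which factors through the projective
    module Q0 + P1. *)
Lemma syzygy_projective (Q0 K : lmodType R) (i : {linear K -> Q0})
    (A : {linear Q0 -> M}) : projective Q0 -> (forall x, exists y, A y = x) ->
  injective i -> (forall y, A y = 0 <-> exists z, i z = y) -> projective K.
Proof.
move=> hQ Asurj iinj Aker.
have [al [be [hal hbe hab]]] := presentation_homotopy hQ Asurj.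
pose h := (idfun : {linear Q0 -> Q0}) \- (be \o al).
have [h0 hh0] : exists h0 : {linear Q0 -> K}, forall x, i (h0 x) = h x.
  by apply: proj_lift => // x; apply/Aker; exact: hab.
have [al1 hal1] : exists al1 : {linear K -> P1}, forall x, d (al1 x) = al (i x).
  have ex x : exists y, d y = al (i x).
    by apply/aker; rewrite hal; apply/Aker; exists x.
  have /choice[s hs] := ex.
  suff sl : linear s by exists (mkLin sl).
  by move=> c x y; apply: dinj; rewrite linearP !hs !linearP.
have [be1 hbe1] : exists be1 : {linear P1 -> K}, forall x, i (be1 x) = be (d x).
  apply: (proj_lift (f := be \o d)) => // x; apply/Aker => /=.
  by rewrite hbe; apply/aker; exists x.
have idE x : h0 (i x) + be1 (al1 x) = x.
  by apply: iinj; rewrite linearD /= hh0 hbe1 hal1 /= subrK.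
move=> B C g f gsurj.
have [l0 hl0] := hQ _ _ g (f \o h0) gsurj.
have [l1 hl1] := @hP1 _ _ g (f \o be1) gsurj.
exists ((l0 \o i) \+ (l1 \o al1)) => x.
by rewrite /= linearD /= hl0 hl1 /= -linearD idE.
Qed.

(** Vanishing is required for every resolution P, so P is compared with the given presentation up to
    homotopy. *)
Lemma Ext_eq0_of_presentation Y : ext_along Y d ->
  forall i, (1 <= i)%N -> Ext_eq0 i M Y.
Proof.
move=> hY i i1 P f fc.
pose D n := res_diff P n; pose A := res_aug P.
have [al [be [hal hbe hab]]] :=
  presentation_homotopy (@res_proj _ _ P 0) (@res_surj _ _ P).
have [h0 hh0] : exists h0 : {linear P 0 -> P 1%N},
    forall x, D 0%N (h0 x) = ((idfun : {linear P 0 -> P 0}) \- (be \o al)) x.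
  by apply: (proj_lift (@res_proj _ _ P 0)) => x; apply/res_exact0; exact: hab.
have [al1 hal1] : exists al1 : {linear P 1%N -> P1},
    forall x, d (al1 x) = (al \o D 0%N) x.
  apply: (proj_lift (@res_proj _ _ P 1)) => x; apply/aker => /=.
  by rewrite hal; apply/res_exact0; exists x.
have [be1 hbe1] : exists be1 : {linear P1 -> P 1%N},
    forall x, D 0%N (be1 x) = (be \o d) x.
  apply: proj_lift => // x; apply/res_exact0 => /=.
  by rewrite hbe; apply/aker; exists x.
have hD0 x : D 0%N (x - h0 (D 0%N x) - be1 (al1 x)) = 0.
  by rewrite !linearB /= hh0 hbe1 /= hal1 /= subKr subrr.
have hD1 n x : D n (D n.+1 x) = 0 by apply/res_exactS; exists x.
case: i i1 f fc => // -[_ f fc /=|i _].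
  (* The cocycle f equals [f h0 D + f be1 al1]; [f be1] extends along d, and [d al1 = al D]. *)
  have [g0 hg0] := hY (f \o be1).
  exists ((g0 \o al) \+ (f \o h0)) => x /=.
  have := hal1 x; rewrite /= => <-; rewrite hg0 /=.
  have /res_exactS[z hz] := hD0 x.
  have : f (x - h0 (D 0%N x) - be1 (al1 x)) = 0 by rewrite -hz fc.
  by rewrite !linearB /= => /eqP; rewrite -addrA -opprD subr_eq0 addrC => /eqP.
(* Beyond degree 1 the presentation is zero, so P contracts there: D h D = D, which makes a cocycle
   f equal to f h D. *)
suff [h hh] : exists h : {linear P i.+1 -> P i.+2},
    forall x, D i.+1 (h (D i.+1 x)) = D i.+1 x.
  move=> f fc; exists (f \o h) => x /=; apply/eqP; rewrite -subr_eq0 -linearB.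
  have /res_exactS[z <-] : D i.+1 (x - h (D i.+1 x)) = 0.
    by rewrite linearB /= hh subrr.
  by rewrite fc.
elim: i => [|i [h hh]].
  have [|h hh] := proj_lift (g := D 1%N)
    (f := (idfun : {linear P 1%N -> P 1%N}) \- (h0 \o D 0%N) \- (be1 \o al1))
    (@res_proj _ _ P 1).
    by move=> x; apply/res_exactS/hD0.
  exists h => x; rewrite hh /= hD1 linear0 subr0.
  have -> : al1 (D 1%N x) = 0 by apply: (inj_eq0 dinj); rewrite hal1 /= hD1 linear0.
  by rewrite linear0 subr0.
have [|h' hh'] := proj_lift (g := D i.+2)
  (f := (idfun : {linear P i.+2 -> P i.+2}) \- (h \o D i.+1)) (@res_proj _ _ P i.+2).
  by move=> x; apply/res_exactS; rewrite /= linearB /= hh subrr.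
by exists h' => x; rewrite hh' /= hD1 linear0 subr0.
Qed.

Lemma ext_along_of_Ext_eq0 Y : Ext_eq0 1 M Y -> ext_along Y d.
Proof.
move=> hE f; have [|g hg] := @hE (short_res hP1 hP0 dinj asurj aker) f.
  by move=> y /=; rewrite linear0.
by exists g.
Qed.

End Comparison.

Section PdimOne.
Variable R : comPzRingType.

Lemma pdim_le1_presentation (M : lmodType R) : pdim_le M 1 ->
  exists (P1 P0 : lmodType R) (d : {linear P1 -> P0}) (a : {linear P0 -> M}),
    [/\ projective P1, projective P0, injective d,
     (forall x, exists y, a y = x) & (forall y, a y = 0 <-> exists z, d z = y)].
Proof.
move=> [P hP]; exists (P 1%N), (P 0%N), (res_diff P 0), (res_aug P).
split; [exact: res_proj | exact: res_proj | | exact: res_surj |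
        exact: res_exact0].
by apply: eq0_inj => x /res_exactS[z <-]; rewrite (hP 2%N isT z) linear0.
Qed.

(** The modules of projective dimension at most 1 are the cokernels of injections between
    projectives. *)
Lemma right_perp_pdim_le1P (Y : lmodType R) : right_perp (pdim_le1 R) Y <->
  forall (P1 P0 : lmodType R) (d : {linear P1 -> P0}),
    projective P1 -> projective P0 -> injective d -> ext_along Y d.
Proof.
split=> [hY P1 P0 d hP1 hP0 dinj|hY M].
  have aker y : qpi (ims d) y = 0 <-> exists z, d z = y by exact: qpi_eq0.
  have asurj := @qpi_surj _ _ (ims d).
  apply: (ext_along_of_Ext_eq0 hP1 hP0 dinj asurj aker).
  by apply: hY => //; exact: (short_pdim_le1 hP1 hP0 dinj asurj aker).
move=> /pdim_le1_presentation[P1 [P0 [d [a [hP1 hP0 dinj asurj aker]]]]].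
by apply: (Ext_eq0_of_presentation hP1 hP0 dinj asurj aker); exact: hY.
Qed.

End PdimOne.

(** * Baer's argument and the characters of an abelian group *)

Section ZornExtension.
Variables (R : comPzRingType) (G Y : lmodType R).

(** Such a T is the graph of a linear map defined on a submodule of G. *)
Definition functional (T : submod (G * Y)%type) := forall y, T (0, y) -> y = 0.

Lemma functional_eq (T : submod (G * Y)%type) x y z :
  functional T -> T (x, y) -> T (x, z) -> y = z.
Proof.
move=> hT hy hz; apply/eqP; rewrite -subr_eq0; apply/eqP/hT.
by rewrite -[X in (X, _)](subrr x); exact: (smemB hy hz).
Qed.

(** Baer's argument: the condition on y is what allows v |-> y to be added to the graph T, so a
    maximal graph is defined everywhere. *)
Lemma graph_extension (T0 : submod (G * Y)%type) : functional T0 ->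
  (forall T : submod (G * Y)%type, functional T -> (forall u, T0 u -> T u) ->
    forall v, exists y, forall t z, T (t *: v, z) -> z = t *: y) ->
  exists g : {linear G -> Y}, forall x y, T0 (x, y) -> g x = y.
Proof.
move=> fT0 step.
pose partial_extension (A : set (G * Y)) := exists2 T : submod (G * Y)%type,
  functional T /\ (forall u, T0 u -> T u) & A = [set u | T u].
have [F goodF chainF|A [PA Amax]] :=
    @Zorn_bigcup (G * Y)%type [set A | A = set0 \/ partial_extension A].
  have [[B FB [b Bb]]|h] := EM (exists2 B, F B & exists b, B b); last first.
    left; apply/seteqP; split=> // u [C FC Cu].
    by apply: h; exists C => //; exists u.
  right.
  have goodE C u : F C -> C u -> exists2 T : submod (G * Y)%type,
      functional T /\ (forall u, T0 u -> T u) & C = [set u | T u].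
    by move=> FC Cu; case: (goodF C FC) => // C0; rewrite C0 in Cu.
  have [T [fT TT0] BT] := goodE B b FB Bb.
  have U0 : (\bigcup_(X in F) X) 0 by exists B => //; rewrite BT; exact: smem0.
  have UL a x y : (\bigcup_(X in F) X) x -> (\bigcup_(X in F) X) y ->
      (\bigcup_(X in F) X) (a *: x + y).
    move=> [C FC Cx] [D FD Dy].
    have [CD|DC] := chainF C D FC FD.
    - exists D => //; have [T' _ e] := goodE D y FD Dy.
      by move: (CD _ Cx) Dy; rewrite e; exact: smemL.
    - exists C => //; have [T' _ e] := goodE C x FC Cx.
      by move: Cx (DC _ Dy); rewrite e; exact: smemL.
  exists (Submod U0 UL) => //; split=> [y [C FC Cy]|u /TT0 Tu].
    by have [T' [fT' _] e] := goodE C (0, y) FC Cy; move: Cy; rewrite e; exact: fT'.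
  by exists B => //; rewrite BT.
have [T [fT TT0] AT] : partial_extension A.
  case: PA => // A0; exfalso; apply: (Amax [set u | T0 u]).
    by rewrite A0; split=> // /(_ 0 (smem0 T0)).
  by right; exists T0.
have total v : exists y, T (v, y).
  have [y hy] := step T fT TT0 v.
  exists y; apply: contrapT => Tvy.
  pose T' (u : G * Y) := exists w (t : R), T w /\ u = w + t *: (v, y).
  have T'0 : T' 0 by exists 0, 0; rewrite scale0r addr0; split=> //; exact: smem0.
  have T'L a u u' : T' u -> T' u' -> T' (a *: u + u').
    move=> [w [t [Tw ->]]] [w' [t' [Tw' ->]]].
    exists (a *: w + w'), (a * t + t'); split; first exact: smemL.
    by rewrite scalerDr scalerDl addrACA scalerA.
  have TT' u : T u -> T' u by exists u, 0; rewrite scale0r addr0.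
  apply: (Amax [set u | T' u]).
    split=> [u|]; first by rewrite AT; exact: TT'.
    move/(_ (v, y)); rewrite AT => h; apply/Tvy/h.
    by exists 0, 1; rewrite scale1r add0r; split=> //; exact: smem0.
  right; exists (Submod T'0 T'L) => //; split=> [z|u /TT0/TT'//].
  move=> [[x w] [t [Txw [/esym/eqP + ->]]]]; rewrite addr_eq0 => /eqP xt /=.
  have := smemN Txw; rewrite xt /= => Tn.
  have /hy : T (t *: v, - w) by move: Tn; rewrite -[- (_, _)]/(- - _, - w) opprK.
  by move=> <-; rewrite subrr.
have [g hg] := choice total.
have gl : linear g.
  by move=> a x y; apply: (functional_eq fT (hg _)); exact: (smemL a (hg x) (hg y)).
by exists (mkLin gl) => x y /TT0; exact: (functional_eq fT (hg x)).
Qed.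

End ZornExtension.

Section Characters.

Definition int_divisible (D : lmodType int) :=
  forall n (y : D), n != 0 -> exists z, y = n *: z.

(** The integers t with t v in the domain are the multiples of a least m > 0, or only 0; y is chosen
    so that m y is the value at m v. *)
Lemma int_divisible_extension (G D : lmodType int) (T0 : submod (G * D)%type) :
  int_divisible D -> functional T0 ->
  exists g : {linear G -> D}, forall x y, T0 (x, y) -> g x = y.
Proof.
move=> hD fT0; apply: graph_extension => // T fT _ v.
pose P n := `[< (0 < n)%N /\ exists z, T (n%:Z *: v, z) >].
have [[n Pn]|h] := EM (exists n, P n); last first.
  exists 0 => t z Tz; rewrite scaler0; apply: fT.
  suff t0 : t = 0 by rewrite -[X in (X, _)](scale0r v) -t0.
  apply: contrapT => /eqP t0; apply: h; exists `|t|%N; apply/asboolP.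
  split; first by rewrite absz_gt0.
  have [tp|tn] := Order.TotalTheory.leP 0 t; first by exists z; rewrite gez0_abs.
  by exists (- z); rewrite ltz0_abs // scaleNr; exact: (smemN Tz).
have [m /asboolP[m0 [z0 Tm]] mmin] := ex_minnP (ex_intro _ n Pn).
have [y zy] := hD m%:Z z0 (lt0n_neq0 m0).
exists y => t z Tz.
have r0 : (t %% m%:Z)%Z = 0.
  apply: contrapT => /eqP r0.
  have rp : (0 <= (t %% m%:Z)%Z) by rewrite modz_ge0 // (lt0n_neq0 m0).
  have : (m <= `|(t %% m%:Z)%Z|)%N.
    apply: mmin; apply/asboolP; split; first by rewrite absz_gt0.
    exists (z - (t %/ m%:Z)%Z *: z0); rewrite gez0_abs //.
    suff -> : (t %% m%:Z)%Z *: v = t *: v - (t %/ m%:Z)%Z *: (m%:Z *: v).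
      exact: (smemB Tz (smemZ _ Tm)).
    by rewrite scalerA -scalerBl.
  rewrite leqNgt -ltz_nat gez0_abs // ltz_pmod //.
have tE : t = (t %/ m%:Z)%Z * m%:Z by rewrite {1}(divz_eq t m%:Z) r0 addr0.
apply: (functional_eq fT Tz); rewrite tE -!scalerA -zy.
exact: (smemZ _ Tm).
Qed.

Definition rat_int : submod (zmodule rat).
Proof.
exists (fun q : rat => exists n : int, q = n%:~R); first by exists 0.
move=> a _ _ [n ->] [m ->]; exists (a * n + m).
by rewrite scalezrE -mulrzl rmorphD rmorphM.
Defined.

Definition rat_mod_int : lmodType int := quotmod rat_int.

Lemma rat_mod_int_divisible : int_divisible rat_mod_int.
Proof.
move=> n y n0; have [q <-] := qpi_surj y.
exists (qpi rat_int (q / n%:~R)); rewrite -linearZ /=; congr \pi.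
by rewrite scalezrE -mulrzl mulrC divfK // intr_eq0.
Qed.

Lemma rat_mod_int_frac (m : nat) : (1 < m)%N ->
  qpi rat_int (m%:~R^-1) <> 0.
Proof.
move=> m1 /qpi_eq0[n].
have m0 : (m%:~R : rat) != 0 by rewrite intr_eq0; case: m m1.
move/(congr1 (fun q => q * m%:~R)); rewrite mulVf // -rmorphM /=.
move/eqP; rewrite -[1]/(1%:~R) eqr_int => /eqP h.
have := congr1 absz h; rewrite abszM /= => /esym/eqP; rewrite muln_eq1 => /andP[_].
by move: m1; case: m {m0 h} => [|[|m]].
Qed.

(** The element x is sent to 1/m if it has finite order m and to 1/2 otherwise; this extends from
    the subgroup generated by x by divisibility. *)
Lemma character_separates (N : lmodType int) (x : N) : x <> 0 ->
  exists g : {linear N -> rat_mod_int}, g x <> 0.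
Proof.
move=> x0; suff [d d0 hd] : exists2 d : rat_mod_int, d <> 0 &
    forall t : int, t *: x = 0 -> t *: d = 0.
  pose T0 (u : N * rat_mod_int) := exists t : int, u = t *: (x, d).
  have T00 : T0 0 by exists 0; rewrite scale0r.
  have T0L a u w : T0 u -> T0 w -> T0 (a *: u + w).
    by move=> [t ->] [t' ->]; exists (a * t + t'); rewrite scalerDl scalerA.
  have [|g hg] := int_divisible_extension (T0 := Submod T00 T0L) rat_mod_int_divisible.
    by move=> y [t [/esym/hd td ->]]; exact: td.
  exists g; rewrite (hg x d) //.
  by exists 1; rewrite scale1r.
pose P n := `[< (0 < n)%N /\ n%:Z *: x = 0 >].
have [[n Pn]|h] := EM (exists n, P n); last first.
  exists (qpi rat_int (2%:~R^-1)); first exact: rat_mod_int_frac.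
  move=> t tx; suff -> : t = 0 by rewrite scale0r.
  apply: contrapT => /eqP t0; apply: h; exists `|t|%N; apply/asboolP.
  split; first by rewrite absz_gt0.
  have [tp|tn] := Order.TotalTheory.leP 0 t; first by rewrite gez0_abs.
  by rewrite ltz0_abs // scaleNr tx oppr0.
have [m /asboolP[m0 mx] mmin] := ex_minnP (ex_intro _ n Pn).
have m1 : (1 < m)%N.
  rewrite ltn_neqAle m0 andbT; apply/eqP => e; apply: x0.
  by rewrite -mx -e scale1r.
exists (qpi rat_int (m%:~R^-1)); first exact: rat_mod_int_frac.
move=> t tx.
have r0 : (t %% m%:Z)%Z = 0.
  apply: contrapT => /eqP r0.
  have rp : (0 <= (t %% m%:Z)%Z) by rewrite modz_ge0 // (lt0n_neq0 m0).
  have : (m <= `|(t %% m%:Z)%Z|)%N.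
    apply: mmin; apply/asboolP; split; first by rewrite absz_gt0.
    rewrite gez0_abs // -[_ *: x]subr0 -tx -[X in _ - X]scale1r.
    have -> : (t %% m%:Z)%Z = t - (t %/ m%:Z)%Z * m%:Z.
      by rewrite {2}(divz_eq t m%:Z) addrC addKr.
    by rewrite scalerBl -scalerA mx scaler0 subr0 scale1r subrr.
  by rewrite leqNgt -ltz_nat gez0_abs // ltz_pmod.
rewrite -linearZ; apply/qpi_eq0; exists (t %/ m%:Z)%Z.
rewrite scalezrE -mulrzl {1}(divz_eq t m%:Z) r0 addr0 rmorphM mulfK //.
by rewrite intr_eq0 (lt0n_neq0 m0).
Qed.

End Characters.

(** * Enough injectives and the hereditary cotorsion pair *)

Section EnoughInjectives.
Variable R : comPzRingType.

Definition injective_mod (E : lmodType R) :=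
  forall (A B : lmodType R) (d : {linear A -> B}), injective d -> ext_along E d.

Section Coinduced.
Variable X : Type.

(** A product over X of copies of the character module of R, the additive maps from R to the
    rationals modulo the integers. *)
Definition coind_sub : submod (X * R -> rat_mod_int).
Proof.
exists (fun h => forall x r s, h (x, r + s) = h (x, r) + h (x, s)).
  by move=> x r s; rewrite /GRing.zero /= addr0.
move=> a h k hh hk x r s.
have aE p : (a *: h + k) p = a *: h p + k p by [].
by rewrite !aE hh hk scalerDr addrACA.
Defined.

Definition coind := submod_type coind_sub.
(** Only the additive group is kept: the scalars are to be those of R, not the integers. *)
HB.instance Definition _ := GRing.Zmodule.on coind.

Definition cval (h : coind) x r : rat_mod_int := sincl coind_sub h (x, r).

Lemma cvalDr h x : {morph cval h x : r s / r + s}.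
Proof. by move=> r s; exact: (sinclP h). Qed.

Lemma cvalD h k x r : cval (h + k) x r = cval h x r + cval k x r.
Proof. by []. Qed.

Lemma cvalMz h x r (n : int) : cval (h *~ n) x r = cval h x r *~ n.
Proof.
have nat_case m : cval (h *+ m) x r = cval h x r *+ m.
  by elim: m => [|m IH]; rewrite ?mulr0n // !mulrS cvalD IH.
by case: n => n; rewrite ?NegzE ?mulrNz -!pmulrn -?nat_case.
Qed.

Lemma cval_ext h k : (forall x r, cval h x r = cval k x r) -> h = k.
Proof. by move=> hk; apply: sincl_inj; apply/funext => -[x r]; exact: hk. Qed.

Definition mkcoind (f : X -> R -> rat_mod_int)
  (hf : forall x, {morph f x : r s / r + s}) : coind :=
  @smk _ _ coind_sub (fun p => f p.1 p.2) hf.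

Lemma cval_mk f hf x r : cval (@mkcoind f hf) x r = f x r.
Proof. by []. Qed.

Lemma cscale_proof (a : R) (h : coind) x :
  {morph (fun r => cval h x (r * a)) : r s / r + s}.
Proof. by move=> r s; rewrite mulrDl cvalDr. Qed.

Definition cscale (a : R) (h : coind) : coind := mkcoind (cscale_proof a h).

Lemma cscaleA a b h : cscale a (cscale b h) = cscale (a * b) h.
Proof. by apply: cval_ext => x r; rewrite !cval_mk mulrA. Qed.
Lemma cscale1 : left_id 1 cscale.
Proof. by move=> h; apply: cval_ext => x r; rewrite cval_mk mulr1. Qed.
Lemma cscaleDr : right_distributive cscale +%R.
Proof. by move=> a h k; apply: cval_ext => x r; rewrite cvalD !cval_mk cvalD. Qed.
Lemma cscaleDl h : {morph cscale^~ h : a b / a + b}.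
Proof.
by move=> a b; apply: cval_ext => x r; rewrite cvalD !cval_mk mulrDr cvalDr.
Qed.

HB.instance Definition _ := GRing.Zmodule_isLmodule.Build R coind
  cscaleA cscale1 cscaleDr cscaleDl.

Lemma cvalZ a h x r : cval (a *: h) x r = cval h x (r * a).
Proof. by []. Qed.

(** A linear map into [coind] amounts to a family of additive maps, read off at r = 1, and these
    extend because their target is divisible. *)
Lemma coind_injective : injective_mod coind.
Proof.
move=> A B d dinj f.
have step x : exists g : {linear zmodule B -> rat_mod_int},
    forall a, g (d a) = cval (f a) x 1.
  pose T0 (u : zmodule B * rat_mod_int) :=
    exists a : A, u.1 = d a /\ u.2 = cval (f a) x 1.
  have T00 : T0 0 by exists 0; rewrite !linear0.
  have T0L (n : int) u w : T0 u -> T0 w -> T0 (n *: u + w).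
    move=> [a [e1 e2]] [b [e1' e2']]; exists (a *~ n + b); split.
      by rewrite (linearD d) (raddfMz d) /= -e1 -e1'.
    by rewrite (linearD f) (raddfMz f) /= cvalD cvalMz -e2 -e2' -scaler_int intz.
  have [|g hg] := int_divisible_extension (T0 := Submod T00 T0L) rat_mod_int_divisible.
    by move=> y [a /= [/esym/(inj_eq0 dinj) -> ->]]; rewrite linear0.
  by exists g => a; apply: hg; exists a.
have [g hg] := choice step.
have gm b x : {morph (fun r : R => g x (r *: b)) : r s / r + s}.
  by move=> r s; rewrite scalerDl; exact: (raddfD (g x)).
have gl : linear (fun b => mkcoind (gm b)).
  move=> a b c; apply: cval_ext => x r; rewrite cvalD cvalZ !cval_mk.
  by rewrite scalerDr scalerA; exact: (raddfD (g x)).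
exists (mkLin gl) => a; apply: cval_ext => x r; rewrite cval_mk.
by rewrite -linearZ /= hg linearZ /= cvalZ mul1r.
Qed.

End Coinduced.

(** N embeds into the product indexed by all its characters, since they separate its points. *)
Lemma enough_injectives (N : lmodType R) :
  exists (E : lmodType R) (i : {linear N -> E}), injective_mod E /\ injective i.
Proof.
pose X := {linear zmodule N -> rat_mod_int}.
have im n (x : X) : {morph (fun r : R => x (r *: n)) : r s / r + s}.
  by move=> r s; rewrite scalerDl; exact: (raddfD x).
have il : linear (fun n => mkcoind (im n)).
  move=> a b c; apply: cval_ext => x r; rewrite cvalD cvalZ !cval_mk.
  by rewrite scalerDr scalerA; exact: (raddfD x).
exists (coind X), (mkLin il); split; first exact: coind_injective.
apply: eq0_inj => n hn; apply: contrapT => /(@character_separates (zmodule N))[x].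
by apply; have := congr1 (fun h => cval h x 1) hn; rewrite cval_mk scale1r.
Qed.

End EnoughInjectives.

(** * Free resolutions and the cotorsion pair of P_1 *)

Section FreeResolution.
Variable R : comPzRingType.

(** The modules are packed with the map so that a resolution can be built by recursion on its
    arrows. *)
Record module_map := Arrow {
  asrc : lmodType R; atgt : lmodType R; amap : {linear asrc -> atgt} }.

Definition free_cover (M : lmodType R) : {linear free_module R M -> M} := linext id.

Lemma cover_surj M x : exists y, free_cover M y = x.
Proof. by exists (delta R x); exact: linext_delta. Qed.

Definition next_arrow (u : module_map) : module_map :=
  @Arrow (free_module R (submod_type (kers (amap u)))) (asrc u)
    (sincl (kers (amap u)) \o free_cover _).

Lemma next_arrow_exact u y :
  amap u y = 0 <-> exists z, amap (next_arrow u) z = y.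
Proof.
split=> [h|[z <-]]; last exact: (sinclP (S := kers (amap u))) (free_cover _ z).
have [z hz] := cover_surj (smk (S := kers (amap u)) h).
by exists z; exact: (congr1 (sincl _) hz).
Qed.

Variable M : lmodType R.

Fixpoint res_arrow n : module_map :=
  if n is n'.+1 then next_arrow (res_arrow n') else Arrow (free_cover M).

Lemma res_arrow_proj n : projective (asrc (res_arrow n)).
Proof. by case: n => [|n]; exact: free_projective. Qed.

Definition free_res : proj_resolution M :=
  @ProjResolution R M (fun n => asrc (res_arrow n))
    (fun n => amap (res_arrow n.+1)) (free_cover M) res_arrow_proj
    (@cover_surj M) (@next_arrow_exact (Arrow (free_cover M)))
    (fun n => @next_arrow_exact (res_arrow n.+1)).

End FreeResolution.

(** Embed the second syzygy K1 of X into an injective E. Then E/K1 is in P_1^perp, and Ext^1(X,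
    E/K1) = 0 splits K1 off the free cover of the first syzygy K0, which is therefore projective. *)
Lemma pdim_le1_hereditary (R : comPzRingType) :
  hereditary_cotorsion_pair (pdim_le1 R) (right_perp (pdim_le1 R)).
Proof.
split=> [X|//]; split=> [hX Y hY|hX]; first exact: hY.
pose K0 := kers (free_cover X).
pose L1 := free_cover (submod_type K0).
pose K1 := kers L1.
have [E [i [Einj iinj]]] := enough_injectives (submod_type K1).
pose q := qpi (ims i).
(* Quotients of injectives qualify: lift from P1 to E, extend to P0, project back. *)
have N'perp : right_perp (pdim_le1 R) (quotmod (ims i)).
  apply/right_perp_pdim_le1P => P1 P0 d hP1 hP0 dinj f.
  have [l hl] := hP1 _ _ q f (@qpi_surj _ _ (ims i)).
  have [g hg] := Einj _ _ d dinj l.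
  by exists (q \o g) => x; rewrite -hl; exact: (congr1 q (hg x)).
have [u hu] := Einj _ _ (sincl K1) (@sincl_inj _ _ K1) i.
have qu x : L1 x = 0 -> q (u x) = 0.
  move=> Lx; apply/qpi_eq0; exists (smk (S := K1) Lx).
  by rewrite -hu.
(* The cocycle [q u] is a coboundary; subtracting a lift to E of its primitive g turns u into a
   retraction onto K1. *)
have [|g hg] := hX _ N'perp 1%N isT (free_res X) (q \o u).
  move=> z; apply: qu; apply: (@sincl_inj _ _ K0); rewrite linear0.
  have h : res_diff (free_res X) 0 (res_diff (free_res X) 1 z) = 0.
    by apply/res_exactS; exists z.
  exact h.
have [l hl] := @free_projective _ X _ _ q g (@qpi_surj _ _ (ims i)).
pose w := u \- (l \o sincl K0 \o L1).
have [r hr] : exists r : {linear free_module R (submod_type K0) -> submod_type K1},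
    forall x, i (r x) = w x.
  apply: proj_lift; first exact: free_projective.
  move=> x; apply/(qpi_eq0 (ims i)).
  have -> : qpi (ims i) (w x) = q (u x) - q (l (sincl K0 (L1 x))).
    exact: (linearB q).
  by rewrite hl; apply/eqP; rewrite subr_eq0; apply/eqP; exact: hg.
have rK x : r (sincl K1 x) = x.
  apply: iinj; rewrite hr.
  transitivity (u (sincl K1 x) - l (sincl K0 (L1 (sincl K1 x)))) => //.
  by rewrite hu (sinclP x) !linear0 addr0.
have K0proj : projective (submod_type K0).
  pose e := (idfun : {linear free_module R (submod_type K0) -> _}) \- (sincl K1 \o r).
  have ex y : exists x, L1 x = y by exact: cover_surj.
  have [s hs] := choice ex.
  have eL x y : L1 x = L1 y -> e x = e y.
    move=> /eqP; rewrite -subr_eq0 -linearB => /eqP h.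
    apply/eqP; rewrite -subr_eq0 -linearB /e /=.
    by rewrite -[x - y]/(sincl K1 (smk (S := K1) h)) rK subrr.
  have sl : linear (e \o s).
    move=> a x y; rewrite -[RHS]linearP; apply: eL.
    by rewrite linearP !hs.
  apply: (@retract_projective _ _ _ (mkLin sl) L1 _ (@free_projective _ _)) => x.
  transitivity (L1 (s x) - L1 (sincl K1 (r (s x)))); first exact: linearB.
  by rewrite hs (sinclP (r (s x))) subr0.
apply: (short_pdim_le1 K0proj (@free_projective _ X) (@sincl_inj _ _ K0)
  (@cover_surj _ X)) => y.
by split=> [h|[z <-]]; [exists (smk (S := K0) h) | exact: (sinclP z)].
Qed.

(** * Splitting injections of projective modules over the fractions *)

Section FiniteSplitting.
Variable R : comPzRingType.
Hypothesis noethR : noetherian R.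

Lemma comb_linear (A B : lmodType R) (a : R) (f g : {linear A -> B}) :
  linear (fun x => a *: f x + g x).
Proof.
by move=> c x y; rewrite (linearP f) (linearP g) !scalerDr !scalerA (mulrC a) addrACA.
Qed.

Lemma torsionless_projective (G : lmodType R) (x : G) : projective G ->
  (forall t : {linear G -> R^o}, t x = 0) -> x = 0.
Proof.
move=> /projective_retract[i [p pi]] h; rewrite -[x]pi.
suff -> : i x = 0 by rewrite linear0.
by apply: fsuppP => g; rewrite linear0; exact: (h (coord g \o i)).
Qed.

(* This replaces McCoy's theorem, which finds a non zero divisor among the
   maximal minors. *)
Lemma full_rank_denominator (b : nat) (T : submod ('I_b -> R^o)) :
  (forall l : 'I_b -> R, (forall w, T w -> \sum_i l i * w i = 0) ->
     forall i, l i = 0) ->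
  exists2 u : R, GRing.lreg u & forall w, T (u *: w).
Proof.
move=> hT.
(* Elimination from the last coordinate: T realizes u times any vector on the last k coordinates. *)
suff H k : (k <= b)%N -> exists2 u : R, GRing.lreg u & forall w : 'I_b -> R^o,
    exists2 w', T w' & forall i : 'I_b, (b - k <= i)%N -> w' i = u * w i.
  have [u ureg hu] := H b (leqnn b); exists u => // w.
  have [w' Tw' e] := hu w.
  by have -> : u *: w = w' by apply/funext => i; rewrite e // subnn.
elim: k => [_|k IH kb].
  exists 1; first exact: lreg1.
  move=> w; exists 0; first exact: smem0.
  by move=> i; rewrite subn0 leqNgt ltn_ord.
have [u ureg hu] := IH (ltnW kb).
have mb : (b - k.+1 < b)%N by rewrite ltn_subrL /= (leq_ltn_trans _ kb).
pose m := Ordinal mb.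
have ltm (i : 'I_b) : (b - k <= i)%N = (m < i)%N by rewrite /= -subSn.
have lem (i : 'I_b) : (b - k.+1 <= i)%N -> i = m \/ (m < i)%N.
  by rewrite leq_eqVlt => /orP[/eqP e|]; [left; exact/val_inj | right].
(* The ideal of entries at m of the vectors of T that vanish beyond m. *)
pose I : set R := [set q | exists2 w, T w & w m = q /\
  forall i : 'I_b, (m < i)%N -> w i = 0].
have idI : ideal I.
  split=> [|_ _ [w Tw [<- hw]] [w' Tw' [<- hw']]|r _ [w Tw [<- hw]]].
  - by exists 0 => //; exact: smem0.
  - exists (w + w'); first exact: smemD.
    by split=> // i mi; rewrite -[LHS]/(w i + w' i) hw // hw' // addr0.
  - exists (r *: w); first exact: smemZ.
    by split=> // i mi; rewrite -[LHS]/(r * w i) hw // mulr0.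
have [[v [Iv vreg]]|h] := EM (exists v, I v /\ GRing.lreg v).
  have [wv Twv [wvm wv0]] := Iv.
  exists (v * u); first exact: lregM.
  move=> w; have [w1 Tw1 hw1] := hu w.
  exists (v *: w1 + (u * w m - w1 m) *: wv).
    by apply: smemD; exact: smemZ.
  move=> i /lem im; rewrite -[LHS]/(v * w1 i + (u * w m - w1 m) * wv i).
  case: im => [->|mi]; first by rewrite wvm; ring.
  by rewrite wv0 // mulr0 addr0 hw1 ?mulrA // ltm.
have [|x x0 Ix] := zero_divisor_ideal noethR idI.
  by move=> a Ia areg; apply: h; exists a.
pose e (i : 'I_b) : 'I_b -> R^o := fun j => (i == j)%:R.
have /choice[y hy] : forall i : 'I_b, exists w', T w' /\
    forall j : 'I_b, (m < j)%N -> w' j = u * e i j.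
  move=> i; have [w' Tw' h'] := hu (e i); exists w'.
  by split=> // j; rewrite -ltm; exact: h'.
(* For w in T, the vector u w - sum_i w_i y_i is in T and vanishes beyond m, so x kills its entry at
   m: l vanishes on T. Then l_m = 0 gives u x = 0. *)
pose l i := (u * e i m - y i m) * x.
have l0 : forall i, l i = 0.
  apply: hT => w Tw.
  have sE j : (\sum_i w i *: y i : 'I_b -> R^o) j = \sum_i w i * y i j.
    by rewrite fct_sumE.
  have ue j : \sum_i w i * (u * e i j) = u * w j.
    rewrite (bigD1 j) //= big1 => [|i ij]; last by rewrite /e (negPf ij) !mulr0.
    by rewrite /e eqxx mulr1 addr0 mulrC.
  pose z := u *: w - \sum_i w i *: y i.
  have zE j : z j = u * w j - \sum_i w i * y i j by rewrite -sE.
  have Iz : I (z m).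
    exists z.
      apply: smemB; first exact: smemZ.
      by apply: smem_sum => i _; apply: smemZ; exact: (hy i).1.
    split=> // j mj; rewrite zE -ue -sumrB big1 // => i _.
    by rewrite (hy i).2 // subrr.
  rewrite -[RHS](Ix _ Iz) zE -ue -sumrB mulr_suml; apply: eq_bigr => i _.
  by rewrite /l; ring.
exfalso; apply: x0; move/lregP: ureg; apply; have := l0 m; rewrite /l mulrBl.
have -> : e m m = 1 by rewrite /e eqxx.
rewrite mulr1 (Ix (y m m)) ?subr0 //.
exists (y m); first exact: (hy m).1.
split=> // i mi; rewrite (hy m).2 // /e; case: eqP mi => [->|]; rewrite ?ltnn ?mulr0 //.
Qed.

(** The map (phi p, 1 - s p) from R^b to G + R^b is injective, so u times each coordinate form of
    R^b factors through it. The components on G give rho. *)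
Lemma fg_projective_section (K G : lmodType R) (phi : {linear K -> G}) :
  projective K -> finitely_generated K -> projective G -> injective phi ->
  exists (u : R) (rho : {linear G -> K}), GRing.lreg u /\
    forall x, rho (phi x) = u *: x.
Proof.
move=> hK [b [v hv]] hG phiinj.
have pil : linear (fun c : 'I_b -> R^o => \sum_i c i *: v i).
  move=> a c c'; rewrite scaler_sumr -big_split /=; apply: eq_bigr => i _.
  by rewrite scalerA -scalerDl.
pose p := mkLin pil.
have [|s hs] := hK _ _ p (idfun : {linear K -> K}).
  by move=> x; have [c ->] := hv x; exists c.
pose e (i : 'I_b) : 'I_b -> R^o := fun j => (i == j)%:R.
have pe i : p (e i) = v i.
  rewrite /p /= (bigD1 i) //= big1 => [|j ji]; last first.
    by rewrite /e eq_sym (negPf ji) scale0r.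
  by rewrite /e eqxx scale1r addr0.
have eE (l : 'I_b -> R^o) : l = \sum_i l i *: e i.
  rewrite fct_sumE; apply/funext => j; rewrite (bigD1 j) //= big1 => [|i ij].
    by rewrite /e -[RHS]/(l j * (j == j)%:R + 0) eqxx mulr1 addr0.
  by rewrite -[LHS]/(l i * (i == j)%:R) (negPf ij) mulr0.
(* Forms on R^b that factor through (phi p, 1 - s p), given by their values on the basis. *)
pose T0 (w : 'I_b -> R^o) := exists (t : {linear G -> R^o})
  (m : {linear ('I_b -> R^o) -> R^o}),
  forall i, w i = t (phi (v i)) + m (e i - s (v i)).
have T00 : T0 0 by exists (lin0 _ _), (lin0 _ _) => i; rewrite addr0.
have T0L a w w' : T0 w -> T0 w' -> T0 (a *: w + w').
  move=> [t [m hw]] [t' [m' hw']].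
  exists (mkLin (comb_linear a t t')), (mkLin (comb_linear a m m')) => i.
  by rewrite -[LHS]/(a *: w i + w' i) hw hw' scalerDr addrACA.
have evl (l : 'I_b -> R^o) (f : {linear ('I_b -> R^o) -> R^o}) :
    f l = \sum_i l i * f (e i).
  by rewrite {1}(eE l) linear_sum; apply: eq_bigr => i _; rewrite linearZ.
have key (l : 'I_b -> R^o) (t : {linear G -> R^o})
    (m : {linear ('I_b -> R^o) -> R^o}) :
    \sum_i l i * (t (phi (v i)) + m (e i - s (v i)))
    = t (phi (p l)) + m (l - s (p l)) :> R^o.
  pose f : {linear ('I_b -> R^o) -> R^o} :=
    (t \o phi \o p) \+ (m \o ((idfun : {linear ('I_b -> R^o) -> _}) \- (s \o p))).
  transitivity (f l) => //; rewrite evl; apply: eq_bigr => i _.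
  by rewrite -[f (e i)]/(t (phi (p (e i))) + m (e i - s (p (e i)))) pe.
have [|u ureg hu] := full_rank_denominator (T := Submod T00 T0L).
  move=> l hl.
  have hl' (t : {linear G -> R^o}) (m : {linear ('I_b -> R^o) -> R^o}) :
      t (phi (p l)) + m (l - s (p l)) = 0.
    by rewrite -key; apply: hl; exists t, m.
  have pl : p l = 0.
    apply: (inj_eq0 phiinj); apply: torsionless_projective => // t.
    by have := hl' t (lin0 _ _); rewrite addr0.
  move=> i.
  have cl : linear (fun c : 'I_b -> R^o => c i) by [].
  by have := hl' (lin0 _ _) (mkLin cl); rewrite pl (linear0 s) subr0 add0r.
have /choice[t ht] : forall k, exists t : {linear G -> R^o},
    exists m : {linear ('I_b -> R^o) -> R^o},
    forall i, u * e k i = t (phi (v i)) + m (e i - s (v i)).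
  by move=> k; exact: hu.
have rl : linear (fun x => \sum_k (t k x : R) *: v k).
  move=> a x y; rewrite scaler_sumr -big_split /=; apply: eq_bigr => i _.
  by rewrite linearP scalerA -scalerDl.
exists u, (mkLin rl); split=> // x.
have px : p (s x) = x by exact: hs.
transitivity (\sum_k (u * s x k) *: v k).
  apply: eq_bigr => k _; congr (_ *: _); have [m hm] := ht k.
  have := key (s x) (t k) m; rewrite px subrr linear0 addr0 => <-.
  under eq_bigr do rewrite -hm.
  rewrite (bigD1 k) //= big1 => [|i ik]; last by rewrite /e eq_sym (negPf ik) !mulr0.
  by rewrite /e eqxx mulr1 addr0 mulrC.
rewrite -{2}px scaler_sumr; apply: eq_bigr => k _; by rewrite scalerA.
Qed.

(** These are the modules over the total ring of fractions, seen as R-modules. *)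
Definition regular_bijective (Y : lmodType R) := forall u : R, GRing.lreg u ->
  (forall y : Y, u *: y = 0 -> y = 0) /\ (forall y : Y, exists z, u *: z = y).

Lemma scale_linear (Y : lmodType R) (a : R) : linear (fun y : Y => a *: y).
Proof. by move=> c x y; rewrite scalerDr !scalerA mulrC. Qed.

(** A solution in Y/S lifts to Y by projectivity of G; the error has values in S and is corrected
    there. *)
Lemma ext_along_extension (F G Y : lmodType R) (phi : {linear F -> G})
  (S : submod Y) : projective G -> ext_along (submod_type S) phi ->
  ext_along (quotmod S) phi -> ext_along Y phi.
Proof.
move=> hG hS hq f; have [g hg] := hq (qpi S \o f).
have [l hl] := hG _ _ (qpi S) g (@qpi_surj _ _ S).
have hd x : S ((f \- (l \o phi)) x).
  apply/qpi_eq0; rewrite (linearB (qpi S)); apply/eqP; rewrite subr_eq0.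
  by apply/eqP; rewrite -[(l \o phi) x]/(l (phi x)) hl hg.
have [k hk] := hS (corestr hd).
exists (l \+ (sincl S \o k)) => x.
rewrite -[LHS]/(l (phi x) + sincl S (k (phi x))) hk corestrE.
by rewrite addrC subrK.
Qed.

(** Let I be maximal among the ideals killing a counterexample Z. It is prime, since otherwise Z is
    an extension of modules killed by larger ideals; then Z is a vector space and Baer's argument
    applies. *)
Lemma regular_bijective_ext (F G Y : lmodType R) (phi : {linear F -> G}) :
  pi_regular_fractions R -> projective F -> projective G -> injective phi ->
  regular_bijective Y -> ext_along Y phi.
Proof.
move=> hpi hF hG phiinj; move: Y.
suff H (Y : lmodType R) : ~ (regular_bijective Y /\ ~ ext_along Y phi).
  by move=> Y hY; apply: contrapT => nY; apply: (H Y).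
move=> [Y0bij Y0ext].
pose B : set (set R) := [set I | ideal I /\ exists Y : lmodType R,
  [/\ regular_bijective Y, forall a (y : Y), I a -> a *: y = 0 & ~ ext_along Y phi]].
have [||I [[idI [Z [Zbij IZ Zext]]] Imax]] := @noetherian_max R noethR B.
- by move=> I [].
- exists [set 0]; split.
    by split=> /= [//|a b -> ->|r a ->]; rewrite ?addr0 ?mulr0.
  by exists Y; split=> // a y ->; rewrite scale0r.
have big J (Y' : lmodType R) : ideal J -> I `<=` J -> ~ J `<=` I ->
    regular_bijective Y' -> (forall a (y : Y'), J a -> a *: y = 0) ->
    ext_along Y' phi.
  move=> idJ IJ nJ bY' JY'; apply: contrapT => nY'; apply/nJ/Imax => //.
  by split=> //; exists Y'.
have [I0 ID IM] := idI.
have pI : prime_ideal I.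
  split=> // [I1|a b Iab].
    apply: Zext => f; exists (lin0 _ _) => x.
    by rewrite -[RHS]scale1r IZ.
  apply: contrapT => /not_orP[Ia Ib].
  (* The submodule a Z is killed by I + Rb, and the quotient Z / a Z by I + Ra. *)
  pose S := ims (mkLin (@scale_linear Z a)).
  have adj c J : (J = fun x => exists2 r, I r & exists q, x = r + q * c) -> ~ I c ->
      ideal J /\ (I `<=` J /\ ~ J `<=` I).
    move=> -> Ic; split; first exact: ideal_adjoin.
    split=> [r Ir|h]; first by exists r => //; exists 0; rewrite mul0r addr0.
    by apply/Ic/h; exists 0 => //; exists 1; rewrite add0r mul1r.
  apply: Zext; apply: (ext_along_extension (S := S)) => //.
  - have [idJ [IJ nJ]] := adj b _ erefl Ib; apply: big idJ IJ nJ _ _.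
    + move=> u ureg; have [uinj usurj] := Zbij u ureg; split=> [y uy|y].
        apply: sincl_inj; rewrite linear0; apply: uinj.
        by have := congr1 (sincl S) uy; rewrite linearZ linear0.
      have [z hz] := sinclP y; have [w hw] := usurj z.
      have Sw : S (a *: w) by exists w.
      exists (smk Sw); apply: sincl_inj; rewrite linearZ sincl_smk -hz -hw /=.
      by rewrite !scalerA mulrC.
    + move=> _ y [r Ir [q ->]]; apply: sincl_inj; rewrite linear0 linearZ.
      have [z <-] := sinclP y; rewrite /= scalerA; apply: IZ.
      rewrite mulrDl; apply: ID; first by rewrite mulrC; exact: IM.
      by rewrite -mulrA (mulrC b); exact: IM.
  - have [idJ [IJ nJ]] := adj a _ erefl Ia; apply: big idJ IJ nJ _ _.
    + move=> u ureg; have [uinj usurj] := Zbij u ureg; split=> [y|y].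
        have [z <-] := qpi_surj y; rewrite -linearZ => /qpi_eq0[w hw].
        have [w' hw'] := usurj w; apply/qpi_eq0; exists w'.
        apply/eqP; rewrite -subr_eq0; apply/eqP/uinj; rewrite scalerBr -hw -hw' /=.
        by rewrite !scalerA mulrC subrr.
      have [z <-] := qpi_surj y; have [w hw] := usurj z.
      by exists (qpi S w); rewrite -linearZ hw.
    + move=> _ y [r Ir [q ->]]; have [z <-] := qpi_surj y.
      rewrite -linearZ; apply/qpi_eq0; exists (q *: z) => /=.
      by rewrite scalerDl (IZ r) // add0r !scalerA mulrC.
have [_ I1 pM] := pI.
have [[u [Iu ureg]]|hreg] := EM (exists u, I u /\ GRing.lreg u).
  apply: Zext => f; exists (lin0 _ _) => x.
  by have [uinj _] := Zbij u ureg; apply/esym/uinj/IZ.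
have [|x x0 Ix] := zero_divisor_ideal noethR idI.
  by move=> a Ia areg; apply: hreg; exists a.
have xI s : s * x = 0 -> I s by exact: pi_regular_prime.
(* So Z is a vector space over the fraction field of R / I. *)
have bij_notin s : ~ I s -> (forall y : Z, s *: y = 0 -> y = 0) /\
    forall y : Z, exists z, s *: z = y.
  move=> nIs; have [n [u [r [ureg usr]]]] := hpi s.
  have Iu : I (u - s * r).
    have : I (s ^+ n * (u - s * r)).
      have -> : s ^+ n * (u - s * r) = u * s ^+ n - s ^+ n.+1 * r.
        by rewrite exprSr; ring.
      by rewrite usr subrr.
    case/pM=> // Isn; exfalso; apply: nIs; elim: n Isn {usr} => [|n IH].
      by rewrite expr0.
    by rewrite exprS => /pM[].
  have usrE (y : Z) : u *: y = s *: (r *: y).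
    by apply/eqP; rewrite -subr_eq0 scalerA -scalerBl; apply/eqP/IZ.
  have [uinj usurj] := Zbij u ureg; split=> y.
    move=> sy; apply: uinj; rewrite usrE scalerA mulrC -scalerA sy scaler0 //.
  by have [z <-] := usurj y; exists (r *: z); rewrite usrE.
apply: Zext => f.
(* The coordinates of such a v are killed by x, hence lie in I, which kills Z. *)
have xf v : x *: v = 0 -> f v = 0.
  move=> xv; have [i [p ip]] := projective_retract hF.
  rewrite -[v]ip (free_sum (i v)) !linear_sum big1 // => w _.
  rewrite !linearZ; apply: IZ; apply: xI.
  have := congr1 (fun c => coord w (i c)) xv.
  by rewrite /= linearZ linear0 /= linearZ linear0 /= mulrC.
(* The graph starts with f on phi F and with 0 on everything killed by x, in particular on I G. *)
pose T0 (u : G * Z) := exists v g, x *: g = 0 /\ u = (phi v + g, f v).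
have T00 : T0 0 by exists 0, 0; rewrite scaler0 !linear0 addr0.
have T0L a u w : T0 u -> T0 w -> T0 (a *: u + w).
  move=> [v [g [hg ->]]] [v' [g' [hg' ->]]].
  exists (a *: v + v'), (a *: g + g'); split.
    by rewrite scalerDr scalerA mulrC -scalerA hg hg' scaler0 addr0.
  by rewrite !linearP; congr pair; rewrite /= scalerDr addrACA.
have [||g hg] := graph_extension (T0 := Submod T00 T0L).
- move=> y [v [g [xg [/esym/eqP]]]]; rewrite addr_eq0 => /eqP e ->.
  apply: xf; apply: (inj_eq0 phiinj).
  by rewrite linearZ /= e scalerN xg oppr0.
- move=> T fT TT0 v.
  have [[s [Is [z Tsz]]]|h] := EM (exists s, ~ I s /\ exists z, T (s *: v, z)).
    have [sinj ssurj] := bij_notin s Is; have [y sy] := ssurj z.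
    exists y => t w Tw; apply/eqP; rewrite -subr_eq0; apply/eqP/sinj.
    apply/eqP; rewrite scalerBr subr_eq0 scalerA mulrC -scalerA sy; apply/eqP.
    apply: (functional_eq fT (x := (s * t) *: v)).
      by rewrite -scalerA; exact: (smemZ s Tw).
    by rewrite mulrC -scalerA; exact: (smemZ t Tsz).
  (* Here t v is in the domain only for t in I, where the value is already 0. *)
  exists 0 => t z Tz; rewrite scaler0; apply: (functional_eq fT Tz).
  have It : I t by apply: contrapT => nIt; apply: h; exists t; split=> //; exists z.
  apply: TT0; exists 0, (t *: v); rewrite !linear0 add0r; split=> //.
  by rewrite scalerA mulrC Ix // scale0r.
exists g => v; apply: hg; exists v, 0; rewrite scaler0 addr0; split=> //.
Qed.

End FiniteSplitting.

(** * Extension to a free module by countable closure *)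

Section CountableClosure.
Variables (R : comPzRingType) (I J : choiceType) (V Y : lmodType R).
Local Notation F := (free_module R I).
Local Notation G := (free_module R J).
Variables (c : {linear F -> V}) (phi : {linear F -> G}) (rho : {linear G -> V}).
Hypothesis cinj : injective c.
Hypothesis rhophi : forall x, rho (phi x) = c x.
Hypothesis Vfrac : forall y : V, exists u x, GRing.lreg u /\ u *: y = c x.
Hypothesis Ydiv : forall u, GRing.lreg u -> forall y : Y, exists z, u *: z = y.
Variable f : {linear F -> Y}.

Definition supported (K : choiceType) (A : set K) : submod (free_module R K).
Proof.
exists (fun x => forall i, coord i x != 0 -> A i) => [i|a x y hx hy i].
  by rewrite linear0 eqxx.
rewrite linearP /=; apply: contraNP => nA; apply/eqP.
have cx0 : coord i x = 0 by apply/eqP; apply: contrapT => /negP/hx.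
have cy0 : coord i y = 0 by apply/eqP; apply: contrapT => /negP/hy.
by rewrite cx0 cy0 scaler0 addr0.
Defined.

Lemma linext_eq_in (K : choiceType) (M : lmodType R) (A : set K) (v w : K -> M) x :
  (forall i, A i -> v i = w i) -> supported A x -> linext v x = linext w x.
Proof.
move=> vw hx; rewrite !linextE; apply: eq_big_seq => i.
by rewrite mem_supp => /hx/vw ->.
Qed.

Lemma linext0 (K : choiceType) (M : lmodType R) (A : set K) (v : K -> M) x :
  (forall i, A i -> v i = 0) -> supported A x -> linext v x = 0.
Proof.
move=> v0 hx; rewrite (linext_eq_in (w := fun=> 0) v0 hx) linextE big1 // => i _.
by rewrite scaler0.
Qed.

Lemma fractions_choice : exists (den : J -> R) (num : J -> F), forall j,
  GRing.lreg (den j) /\ den j *: rho (delta R j) = c (num j).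
Proof.
have /choice[d hd] : forall j, exists p : R * F,
    GRing.lreg p.1 /\ p.1 *: rho (delta R j) = c p.2.
  by move=> j; have [u [x h]] := Vfrac (rho (delta R j)); exists (u, x).
by exists (fst \o d), (snd \o d).
Qed.

Let den := sval (cid fractions_choice).
Let num := sval (cid (svalP (cid fractions_choice))).
Let denP j : GRing.lreg (den j) /\ den j *: rho (delta R j) = c (num j).
Proof. exact: (svalP (cid (svalP (cid fractions_choice)))). Qed.

(** For such a pair phi maps F_A into G_B and rho maps G_B into the fractions of F_A. *)
Definition closed_pair (A : set I) (B : set J) :=
  (forall i, A i -> supported B (phi (delta R i))) /\
  (forall j, B j -> supported A (num j)).

Definition fraction_sub (A : set I) : submod V.
Proof.
exists (fun y => exists u x, [/\ GRing.lreg u, supported A x & u *: y = c x]).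
  exists 1, 0; split; [exact: lreg1 | exact: smem0 | by rewrite scaler0 linear0].
move=> a y y' [u [x [ureg hx e]]] [u' [x' [u'reg hx' e']]].
exists (u * u'), ((a * u') *: x + u *: x'); split; first exact: lregM.
  by apply: smemD; exact: smemZ.
rewrite [RHS]linearD !linearZ /= -e -e' scalerDr !scalerA; congr (_ *: _ + _).
by ring.
Defined.

(** With u a common denominator of the rho(delta_j) for j in [s], the elements z_j = u rho(delta_j)
    lie in F, and k_j is the value at z_j of e divided by u. The part over B contributes only
    fractions of F_A, where e vanishes. *)
Lemma correction (A A' P : set I) (B : set J) (s : seq J) (e : I -> Y) :
  closed_pair A B -> (forall i, A' i -> e i = 0) -> A `<=` A' ->
  (forall i, P i -> supported (B `|` [set` s]) (phi (delta R i))) ->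
  exists k : J -> Y, [/\ forall j, B j -> k j = 0,
    forall i, P i -> linext k (phi (delta R i)) = e i &
    forall j, supported A' (num j) -> k j = 0].
Proof.
move=> [cA cB] eA' AA' hP.
pose u := \prod_(j <- s) den j.
have ureg : GRing.lreg u.
  rewrite /u; elim/big_ind: _ => [|x y|j _]; first exact: lreg1.
    exact: lregM.
  exact: (denP j).1.
have /choice[w hw] : forall j, exists w, j \in s -> u = w * den j.
  move=> j; have [js|_] := boolP (j \in s); last by exists 0.
  exists (\prod_(i <- rem j s) den i) => _.
  by rewrite /u (big_rem j js) /= mulrC.
(* Dividing 0 must give 0, so that e' still vanishes on A'. *)
have /choice[e' he'] : forall i, exists y, u *: y = e i /\ (e i = 0 -> y = 0).
  move=> i; have [ei|ei] := EM (e i = 0).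
    by exists 0; rewrite scaler0 ei.
  by have [y hy] := Ydiv ureg (e i); exists y.
pose z j := w j *: num j.
have cz j : j \in s -> c (z j) = u *: rho (delta R j).
  by move=> /hw e0; rewrite linearZ /= -(denP j).2 scalerA -e0.
have zA' j : supported A' (num j) -> linext e' (z j) = 0.
  move=> hj; apply: (linext0 (A := A')) => [i /eA'|]; first exact: (he' i).2.
  exact: smemZ.
exists (fun j => if `[< B j >] || (j \notin s) then 0 else linext e' (z j)).
split=> [j Bj|i Pi|j hj]; [by case: asboolP | | by case: ifP => // _; exact: zA'].
set x := phi (delta R i).
pose zz := \sum_(j <- supp x | ~~ `[< B j >]) coord j x *: z j.
have inS j : j \in supp x -> ~~ `[< B j >] -> j \in s.
  by rewrite mem_supp => /(hP i Pi)[/asboolP->|].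
have -> : linext (fun j => if `[< B j >] || (j \notin s) then 0
    else linext e' (z j)) x = linext e' zz.
  rewrite linextE linear_sum [RHS]big_mkcond; apply: eq_big_seq => j js.
  have [Bj|Bj] := boolP `[< B j >]; first by rewrite /= scaler0.
 by rewrite (inS j js Bj); exact/esym/linearZ_LR.
have czz : c zz = u *: (c (delta R i) -
    \sum_(j <- supp x | `[< B j >]) coord j x *: rho (delta R j)).
  have -> : c (delta R i) = \sum_(j <- supp x) coord j x *: rho (delta R j).
    rewrite -rhophi -/x {1}(free_sum x) linear_sum; apply: eq_bigr => j _.
    by rewrite linearZ.
  rewrite [X in X - _](bigID (fun j => `[< B j >])) /= [X in u *: X]addrAC subrr add0r.
  rewrite linear_sum scaler_sumr.
  rewrite big_seq_cond [RHS]big_seq_cond; apply: eq_bigr => j /andP[js Bj].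
  by rewrite linearZ /= cz ?(inS j) // scalerA [X in X *: _]mulrC scalerA.
have [v [x' [vreg hx' vx']]] : fraction_sub A
    (\sum_(j <- supp x | `[< B j >]) coord j x *: rho (delta R j)).
  apply: smem_sum => j /asboolP Bj; apply: smemZ.
  by exists (den j), (num j); split; [exact: (denP j).1 | exact: cB | exact: (denP j).2].
(* A regular multiple of this element lies in F_A, so its coordinates outside A vanish. *)
have zzA : supported A (zz - u *: delta R i).
  have e1 : v *: (zz - u *: delta R i) = (- u) *: x'.
    apply: cinj; transitivity (v *: (c zz - u *: c (delta R i))).
      by rewrite linearZ_LR linearB linearZ_LR.
    rewrite czz [X in v *: (X - _)]scalerBr addrAC subrr sub0r.
    rewrite scalerN scalerA mulrC -scalerA vx'.
    by rewrite [RHS]linearZ_LR /= scaleNr.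
  move=> l hl; apply: hx'; apply: contraNN hl => /eqP x'0.
  apply/eqP; have /lregP := vreg; apply.
  have := congr1 (coord l) e1.
  by rewrite !linearZ /= x'0 scaler0.
apply/eqP; rewrite -(he' i).1 -subr_eq0; apply/eqP.
have <- : linext e' (u *: delta R i) = u *: e' i.
  by rewrite linearZ -[in RHS](linext_delta e').
rewrite -linearB; apply: (linext0 (A := A)) => // l /AA'/eA'.
exact: (he' l).2.
Qed.

(** Only the values of [t.2] on [t.1.2] matter. *)
Definition partial_extension (t : set I * set J * (J -> Y)) :=
  closed_pair t.1.1 t.1.2 /\
  forall i, t.1.1 i -> linext t.2 (phi (delta R i)) = f (delta R i).

Definition extension_le (t t' : set I * set J * (J -> Y)) :=
  [/\ t.1.1 `<=` t'.1.1, t.1.2 `<=` t'.1.2 & forall j, t.1.2 j -> t'.2 j = t.2 j].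

(** Closing up i0 takes countably many finite levels. Correcting level by level leaves the value at
    j alone once the support of [num j] has been reached, so a limit map exists. *)
Lemma partial_extension_step t i0 : partial_extension t ->
  exists t', [/\ partial_extension t', extension_le t t' & t'.1.1 i0].
Proof.
case: t => -[A B] g [/= cAB gf]; have [cA cB] := cAB.
(* Each level adds the supports of the images of the previous one; i0 enters at level 1. *)
pose lev := fix lev n : seq I * seq J := if n is n'.+1 then
    (i0 :: (lev n').1 ++ flatten [seq supp (num j) | j <- (lev n').2],
     (lev n').2 ++ flatten [seq supp (phi (delta R i)) | i <- (lev n').1])
  else ([::], [::]).
pose An n := A `|` [set` (lev n).1]; pose Bn n := B `|` [set` (lev n).2].
have supAB n i : An n i -> supported (Bn n.+1) (phi (delta R i)).
  move=> [Ai|/= li] j; first by move/(cA i Ai); left.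
  rewrite -mem_supp => js; right; rewrite /= mem_cat; apply/orP; right.
  by apply/flattenP; exists (supp (phi (delta R i))) => //; exact: map_f.
have supBA n j : Bn n j -> supported (An n.+1) (num j).
  move=> [Bj|/= lj] i; first by move/(cB j Bj); left.
  rewrite -mem_supp => js; right; rewrite /= inE mem_cat; apply/orP; right.
  apply/orP; right.
  by apply/flattenP; exists (supp (num j)) => //; exact: map_f.
have incA n i : An n i -> An n.+1 i.
  by move=> [|/= li]; [left | right; rewrite /= inE mem_cat li orbT].
pose inv n (h : J -> Y) := (forall j, B j -> h j = g j) /\
  forall i, An n i -> linext h (phi (delta R i)) = f (delta R i).
have step n h : inv n h -> exists h', inv n.+1 h' /\
    forall j, supported (An n) (num j) -> h' j = h j.
  move=> [hB hA].
  pose e i := if `[< An n.+1 i >] then f (delta R i) - linext h (phi (delta R i)) else 0.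
  (* Level n + 2 is needed: it contains, up to B, the supports of phi(delta_i) for i in A_(n+1). *)
  have [|||k [kB ke kA]] := @correction A (An n) (An n.+1) B (lev n.+2).2 e cAB.
  - by move=> i Ai; rewrite /e hA // subrr; case: asboolP.
  - by move=> i; left.
  - exact: supAB.
  exists (fun j => h j + k j); split; last by move=> j /kA ->; rewrite addr0.
  split=> [j Bj|i Ai]; first by rewrite kB // addr0 hB.
  have -> : linext (fun j => h j + k j) (phi (delta R i)) =
      linext h (phi (delta R i)) + linext k (phi (delta R i)).
    rewrite !linextE -big_split /=; apply: eq_bigr => j _.
    by rewrite scalerDr.
  by rewrite ke // /e asboolT // addrC subrK.
have inv0 : inv 0%N g by split=> // i [/gf//|].
pose st := fix st n : {h | inv n h} := match n with
  | 0 => exist _ g inv0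
  | n'.+1 => exist _ (sval (cid (step _ _ (svalP (st n')))))
      (svalP (cid (step _ _ (svalP (st n'))))).1
  end.
pose h n := sval (st n).
have hinv n : inv n (h n) by exact: svalP.
have hst n j : supported (An n) (num j) -> h n.+1 j = h n j.
  exact: (svalP (cid (step _ _ (svalP (st n))))).2.
have incAn m n i : (m <= n)%N -> An m i -> An n i.
  by move=> /subnKC <-; elim: (n - m)%N => [|k IH]; rewrite ?addn0 // addnS => /IH/incA.
(* For j in B_n, [num j] is supported in A_(n+1), so nothing changes at j from step n + 1 on. *)
have stable n j m : Bn n j -> (n < m)%N -> h m j = h n.+1 j.
  move=> Bj /subnKC <-; elim: (m - n.+1)%N => [|k IH]; first by rewrite addn0.
  rewrite addnS hst // => i /(supBA n j Bj); apply: incAn.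
  by rewrite leq_addr.
(* k j is a level containing j, or 0 if no level does. *)
have /choice[k hk] : forall j, exists n, (exists m, j \in (lev m).2) -> j \in (lev n).2.
  move=> j; have [[m hm]|hm] := EM (exists m, j \in (lev m).2); first by exists m.
  by exists 0%N => /hm.
pose hoo j := h (k j).+1 j.
have hooE n j : Bn n j -> hoo j = h n.+1 j.
  move=> [Bj|/= lj]; first by rewrite /hoo !(hinv _).1.
  have kj : Bn (k j) j by right; apply: hk; exists n.
  rewrite /hoo -(stable (k j) j (maxn (k j) n).+1) ?ltnS ?leq_maxl //.
  by rewrite (stable n) // ?ltnS ?leq_maxr //; right.
exists ((fun i => exists n, An n i), (fun j => exists n, Bn n j), hoo); split.
- split=> /=; first split=> [i [n /supAB h'] j /h'|j [n /supBA h'] i /h'].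
  + by exists n.+1.
  + by exists n.+1.
  move=> i [n Ai]; rewrite -((hinv n.+2).2 i); last exact/incA/incA.
  apply: (linext_eq_in (A := Bn n.+1)) => [j|]; first exact: hooE.
  exact: supAB.
- split=> /= [i Ai|j Bj|j Bj]; [by exists 0%N; left | by exists 0%N; left |].
  by rewrite /hoo (hinv _).1.
- by exists 1%N; right; rewrite /= inE eqxx.
Qed.

(** Zorn's lemma: unions bound the chains, and a maximal partial extension contains every i0 by the
    preceding step. *)
Theorem divisible_extension : exists g : {linear G -> Y}, forall x, g (phi x) = f x.
Proof.
have ext0 : partial_extension (set0, set0, fun=> 0) by [].
pose T := {t | partial_extension t}.
pose le (t t' : T) := `[< extension_le (sval t) (sval t') >].
have [|||t tmax] := @ZL_preorder T (exist _ _ ext0) le.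
- by move=> t; apply/asboolP; split.
- move=> t s r /asboolP[a b e] /asboolP[a' b' e']; apply/asboolP; split.
  + by move=> i /a/a'.
  + by move=> j /b/b'.
  + by move=> j tj; rewrite e' ?e //; exact: b.
- move=> C tot.
  have /choice[k hk] : forall j, exists y : Y, forall t : T, C t ->
      (sval t).1.2 j -> (sval t).2 j = y.
    move=> j; have [[t [Ct tj]]|h] := EM (exists t : T, C t /\ (sval t).1.2 j).
      exists ((sval t).2 j) => s Cs sj.
      by case: (tot s t Cs Ct) => /asboolP[_ _ e]; rewrite e.
    by exists 0 => t Ct tj; exfalso; apply: h; exists t.
  pose A i := exists t : T, C t /\ (sval t).1.1 i.
  pose B j := exists t : T, C t /\ (sval t).1.2 j.
  have gAB : partial_extension (A, B, k).
    split=> /=; first split=> [i [t [Ct ti]] j|j [t [Ct tj]] i].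
    + by move=> /((svalP t).1.1 i ti); exists t.
    + by move=> /((svalP t).1.2 j tj); exists t.
    move=> i [t [Ct ti]]; rewrite -((svalP t).2 i ti).
    apply: (linext_eq_in (A := (sval t).1.2)) => [j tj|].
      by rewrite (hk j t).
    exact: ((svalP t).1.1 i ti).
  exists (exist _ _ gAB) => t Ct; apply/asboolP; split=> /= [i ti|j tj|j tj].
  + by exists t.
  + by exists t.
  + by rewrite (hk j t).
exists (linext (sval t).2) => x.
apply: (free_ext (f := linext (sval t).2 \o phi)) => i /=.
have [t' [gt' tt' t'i]] := partial_extension_step i (svalP t).
have /asboolP[ti _ _] : le (exist _ _ gt') t by apply: tmax; exact/asboolP.
by apply: (svalP t).2; exact: ti.
Qed.

End CountableClosure.

(** * Projective dimension one, telescopes and the equivalences *)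

Section FractionModule.
Variable R : comPzRingType.
Local Notation "a %:F" := (@to_total_fractions R a).

Definition qmod := total_fractions R.
HB.instance Definition _ := GRing.ComPzRing.on qmod.

Definition qmod_scale (a : R) (q : qmod) : qmod := a%:F * q.

Lemma qmod_scaleA a b q : qmod_scale a (qmod_scale b q) = qmod_scale (a * b) q.
Proof. by rewrite /qmod_scale rmorphM mulrA. Qed.
Lemma qmod_scale1 : left_id 1 qmod_scale.
Proof. by move=> q; rewrite /qmod_scale rmorph1 mul1r. Qed.
Lemma qmod_scaleDr : right_distributive qmod_scale +%R.
Proof. by move=> a q r; rewrite /qmod_scale mulrDr. Qed.
Lemma qmod_scaleDl q : {morph qmod_scale^~ q : a b / a + b}.
Proof. by move=> a b; rewrite /qmod_scale rmorphD mulrDl. Qed.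

HB.instance Definition _ := GRing.Zmodule_isLmodule.Build R qmod
  qmod_scaleA qmod_scale1 qmod_scaleDr qmod_scaleDl.

Lemma qmodZ (a : R) (q : qmod) : a *: q = a%:F * q :> total_fractions R.
Proof. by []. Qed.

Variable I : choiceType.
Definition fracs := fsupp I qmod.
HB.instance Definition _ := GRing.Lmodule.on fracs.

Lemma fsupp_span (V : lmodType R) (S : submod (fsupp I V)) :
  (forall i v, S (single i v)) -> forall x, S x.
Proof. by move=> h x; rewrite (fsupp_sum x); apply: smem_sum. Qed.

Lemma fracs_bijective : regular_bijective fracs.
Proof.
move=> u /to_total_fractions_unit[t tu]; split=> [y uy|].
  apply: fsuppP => i; rewrite linear0.
  have := congr1 (coord i) uy; rewrite linearZ linear0 => ui.
  have : t * (u%:F * coord i y) = 0 by rewrite -qmodZ [X in t * X]ui mulr0.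
  by rewrite mulrA tu mul1r.
apply: (fsupp_span (S := ims (mkLin (@scale_linear R fracs u)))) => i q.
exists (single i (t * q : qmod)); rewrite -[LHS]/(u *: _) -linearZ.
by congr single; rewrite qmodZ mulrA (mulrC _ t) tu mul1r.
Qed.

Definition to_fracs : {linear free_module R I -> fracs} :=
  linext (fun i => single i (1 : qmod)).

Lemma coord_to_fracs i x : coord i (to_fracs x) = (coord i x)%:F.
Proof.
have fl : linear (fun r : R^o => r%:F : qmod).
  by move=> a r s; rewrite rmorphD rmorphM.
apply: (free_ext (f := coord i \o to_fracs) (g := mkLin fl \o coord i)) => j /=.
rewrite -[linext_fun _ _]/(linext _ (delta R j)) linext_delta /delta !coord_single.
by case: ifP => _; rewrite ?rmorph1 ?rmorph0.
Qed.

Lemma to_fracs_inj : injective to_fracs.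
Proof.
move=> x y xy; apply: fsuppP => i.
have := congr1 (coord i) xy; rewrite !coord_to_fracs.
exact: (@to_total_fractions_inj R).
Qed.

(** The elements having a denominator form a submodule, so one coordinate at a time suffices. *)
Lemma fracs_denominator (y : fracs) :
  exists u x, GRing.lreg u /\ u *: y = to_fracs x.
Proof.
have [i q|u [x [ureg _ e]]] :=
    fsupp_span (S := fraction_sub to_fracs [set: I]) _ y; last by exists u, x.
have [a [s [sreg qs]]] := total_fractionsP q.
exists s, (a *: delta R i); split=> //.
rewrite linearZ_LR linext_delta -!linearZ_LR.
by congr single; rewrite !qmodZ mulr1 mulrC.
Qed.

End FractionModule.

Definition divisible (R : comPzRingType) (Y : lmodType R) :=
  forall u : R, GRing.lreg u -> forall y : Y, exists z, u *: z = y.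

(** * Divisible modules and the vanishing of Ext *)

Section DivisibleModules.
Variable R : comPzRingType.
Hypothesis noethR : noetherian R.

(** Extending R^(I) -> Q^(I) along phi splits phi over Q; the countable closure then clears
    denominators. *)
Lemma divisible_ext_free (I J : choiceType) (Y : lmodType R)
  (phi : {linear free_module R I -> free_module R J}) : pi_regular_fractions R ->
  injective phi -> divisible Y -> ext_along Y phi.
Proof.
move=> hpi phiinj hY f.
have [rho hrho] := regular_bijective_ext noethR hpi (@free_projective R I)
  (@free_projective R J) phiinj (@fracs_bijective R I) (to_fracs R I).
apply: (divisible_extension (@to_fracs_inj R I) hrho) => //.
exact: fracs_denominator.
Qed.

(* Replaces d : P1 -> P0 by an injection of free modules: the summand missing
   to make P1 free is added to both sides. *)
Lemma divisible_ext_along (P1 P0 Y : lmodType R) (d : {linear P1 -> P0}) :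
  pi_regular_fractions R -> projective P1 -> projective P0 -> injective d ->
  divisible Y -> ext_along Y d.
Proof.
move=> hpi hP1 hP0 dinj hY f.
have [i1 [p1 ip1]] := projective_retract hP1.
have [i0 [p0 ip0]] := projective_retract hP0.
pose K := (P0 + P1)%type.
pose in0 : {linear free_module R P0 -> free_module R K} :=
  linext (fun x => delta R (inl x : K)).
pose in1 : {linear free_module R P1 -> free_module R K} :=
  linext (fun x => delta R (inr x : K)).
pose pr0 : {linear free_module R K -> free_module R P0} :=
  linext (fun s => if s is inl x then delta R x else 0).
pose pr1 : {linear free_module R K -> free_module R P1} :=
  linext (fun s => if s is inr x then delta R x else 0).
have e00 x : pr0 (in0 x) = x.
  apply: (free_ext (f := pr0 \o in0) (g := idfun)) => j.
  by rewrite -[LHS]/(pr0 (in0 (delta R j))) !linext_delta.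
have e01 x : pr0 (in1 x) = 0.
  apply: (free_ext (f := pr0 \o in1) (g := lin0 _ _)) => j.
  by rewrite -[LHS]/(pr0 (in1 (delta R j))) !linext_delta.
have e10 x : pr1 (in0 x) = 0.
  apply: (free_ext (f := pr1 \o in0) (g := lin0 _ _)) => j.
  by rewrite -[LHS]/(pr1 (in0 (delta R j))) !linext_delta.
have e11 x : pr1 (in1 x) = x.
  apply: (free_ext (f := pr1 \o in1) (g := idfun)) => j.
  by rewrite -[LHS]/(pr1 (in1 (delta R j))) !linext_delta.
pose phi : {linear free_module R P1 -> free_module R K} := (in0 \o i0 \o d \o p1) \+
  (in1 \o ((idfun : {linear free_module R P1 -> _}) \- (i1 \o p1))).
have phiE l : phi l = in0 (i0 (d (p1 l))) + in1 (l - i1 (p1 l)) by [].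
have phiinj : injective phi.
  apply: eq0_inj => l phil.
  have h0 : i0 (d (p1 l)) = 0.
    have := congr1 pr0 phil.
    by rewrite phiE (linearD pr0) e00 e01 addr0 (linear0 pr0).
  have h1 : l - i1 (p1 l) = 0.
    have := congr1 pr1 phil.
    by rewrite phiE (linearD pr1) e10 e11 add0r (linear0 pr1).
  have pl : p1 l = 0.
    by apply: (inj_eq0 dinj); rewrite -[d _]ip0 h0 (linear0 p0).
  by move: h1; rewrite pl (linear0 i1) subr0.
have [h hh] := divisible_ext_free hpi phiinj hY (f \o p1).
exists (h \o in0 \o i0) => x.
have := hh (i1 x); rewrite phiE ip1 subrr (linear0 in1) addr0 => e.
by rewrite -[LHS]/(h (in0 (i0 (d x)))) e -[LHS]/(f (p1 (i1 x))) ip1.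
Qed.

Lemma divisible_right_perp (Y : lmodType R) : pi_regular_fractions R ->
  divisible Y -> right_perp (pdim_le1 R) Y.
Proof.
move=> hpi hY; apply/right_perp_pdim_le1P => P1 P0 d hP1 hP0 dinj.
exact: divisible_ext_along.
Qed.

(** The first syzygy K is finitely generated projective, with a retraction rho up to u. By
    divisibility f = u l on K, and l rho extends f. *)
Lemma fg_ext_divisible (M Y : lmodType R) : has_fg_proj_resolution M ->
  pdim_le M 1 -> divisible Y -> forall i, (1 <= i)%N -> Ext_eq0 i M Y.
Proof.
move=> [P Pfg] /pdim_le1_presentation[P1 [P0 [d [a [hP1 hP0 dinj asurj aker]]]]] hY.
pose K := submod_type (kers (res_aug P)); pose i := sincl (kers (res_aug P)).
have iinj : injective i by exact: sincl_inj.
have iker y : res_aug P y = 0 <-> exists z, i z = y.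
  by split=> [h|[z <-]]; [exists (smk (S := kers (res_aug P)) h) | exact: (sinclP z)].
have hK : projective K.
  exact: (syzygy_projective hP1 hP0 dinj asurj aker (@res_proj _ _ P 0)
    (@res_surj _ _ P) iinj iker).
have Kfg : finitely_generated K.
  have [n [v hv]] := Pfg 1%N.
  have dv x : kers (res_aug P) (res_diff P 0 x) by apply/res_exact0; exists x.
  pose e := corestr (S := kers (res_aug P)) dv.
  exists n, (fun j => e (v j)) => x.
  have /res_exact0[z hz] : res_aug P (i x) = 0 by exact: (sinclP x).
  have [c hc] := hv z; exists c.
  have -> : x = e z by apply: iinj; rewrite /i corestrE hz.
  by rewrite hc linear_sum; apply: eq_bigr => j _; rewrite linearZ_LR.
have [u [rho [ureg hrho]]] :=
  fg_projective_section noethR hK Kfg (@res_proj _ _ P 0) iinj.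
apply: (Ext_eq0_of_presentation hK (@res_proj _ _ P 0) iinj (@res_surj _ _ P) iker).
move=> f; have [|l hl] := hK _ _ (mkLin (@scale_linear R Y u)) f; first exact: hY.
exists (l \o rho) => x; rewrite -[LHS]/(l (rho (i x))) hrho linearZ_LR.
exact: hl.
Qed.

End DivisibleModules.

(** * The telescope of multiplication by s *)

Section Telescope.
Variables (R : comPzRingType) (s : R).

(** Its cokernel is the colimit of R -> R -> ... along multiplication by s. *)
Definition telescope_map : {linear free_module R nat -> free_module R nat} :=
  linext (fun n => delta R n - s *: delta R n.+1).

Lemma telescope_delta n :
  telescope_map (delta R n) = delta R n - s *: delta R n.+1.
Proof. exact: linext_delta. Qed.

Lemma telescope_coord0 x : coord 0%N (telescope_map x) = coord 0%N x.
Proof.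
apply: (free_ext (f := coord 0%N \o telescope_map) (g := coord 0%N)) => n.
transitivity (coord 0%N (delta R n - s *: delta R n.+1)).
  exact: (congr1 (coord 0%N) (telescope_delta n)).
by rewrite coordB coordZ [X in s *: X]coord_single /= scaler0 subr0.
Qed.

Lemma telescope_coordS n x :
  coord n.+1 (telescope_map x) = coord n.+1 x - s *: coord n x.
Proof.
pose g : {linear free_module R nat -> R^o} :=
  coord n.+1 \- (mkLin (@scale_linear R R^o s) \o coord n).
have gE y : g y = coord n.+1 y - s *: coord n y by [].
rewrite -gE; apply: (free_ext (f := coord n.+1 \o telescope_map)) => m.
transitivity (coord n.+1 (delta R m - s *: delta R m.+1)).
  exact: (congr1 (coord n.+1) (telescope_delta m)).
by rewrite gE coordB coordZ; congr (_ - _ *: _).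
Qed.

Lemma telescope_map_inj : injective telescope_map.
Proof.
apply: eq0_inj => x tx; apply: fsuppP => n; rewrite linear0.
elim: n => [|n IH]; first by rewrite -telescope_coord0 tx linear0.
by have := telescope_coordS n x; rewrite tx linear0 IH scaler0 subr0.
Qed.

(** Iterating g(e_n) = a e_n + s g(e_(n+1)) expands g(e_0); at a coordinate n outside its support,
    this reads 0 = s^n a + s^(n+1) z' for some z'. *)
Lemma telescope_extension (X : lmodType R) (a : X)
  (f g : {linear free_module R nat -> fsupp nat X}) :
  (forall n, f (delta R n) = single n a) ->
  (forall x, g (telescope_map x) = f x) ->
  exists n z, s ^+ n *: a = s ^+ n.+1 *: z.
Proof.
move=> hf hg.
have step n : g (delta R n) = single n a + s *: g (delta R n.+1).
  by apply/eqP; rewrite -subr_eq -hf -hg telescope_delta (linearB g) (linearZ_LR g).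
have sumE k : g (delta R 0%N) =
    \sum_(n < k) s ^+ n *: single (nat_of_ord n) a + s ^+ k *: g (delta R k).
  elim: k => [|k ->]; first by rewrite big_ord0 add0r expr0 scale1r.
  by rewrite big_ord_recr /= -addrA step scalerDr scalerA -exprSr.
have [n hn] : exists n, n \notin supp (g (delta R 0%N)).
  exists (\max_(i <- supp (g (delta R 0%N))) i).+1; apply/negP => h.
  by have := @leq_bigmax_seq _ _ xpredT id _ h isT; rewrite ltnn.
have := congr1 (coord n) (sumE n.+1).
move: hn; rewrite mem_supp negbK => /eqP ->.
rewrite linearD big_ord_recr linearD linear_sum big1 => [|i _]; last first.
  by rewrite /= coordZ coord_single gtn_eqF // scaler0.
rewrite add0r /= !coordZ coord_single eqxx => /esym/eqP.
rewrite addr_eq0 => /eqP e; exists n, (- coord n (g (delta R n.+1))).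
by rewrite e scalerN.
Qed.

End Telescope.

(** * Finitistic dimension zero *)

Section FinitisticDimension.
Variable R : comPzRingType.

Lemma bijective_inverse (A B : lmodType R) (f : {linear A -> B}) :
  injective f -> (forall y, exists x, f x = y) ->
  exists g : {linear B -> A}, forall y, f (g y) = y.
Proof.
move=> finj /choice[g hg].
have gl : linear g by move=> a x y; apply: finj; rewrite linearP !hg.
by exists (mkLin gl).
Qed.

Lemma pdim_le0_projective (M : lmodType R) : pdim_le M 0 -> projective M.
Proof.
move=> [P hP].
have ainj : injective (res_aug P).
  by apply: eq0_inj => x /res_exact0[z <-]; rewrite (hP 1%N isT z) linear0.
have [g hg] := bijective_inverse ainj (@res_surj _ _ P).
exact: (retract_projective hg (@res_proj _ _ P 0)).
Qed.

Lemma projective_pdim_le0 (M : lmodType R) : projective M -> pdim_le M 0.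
Proof.
move=> hM; have inj0 : injective (lin0 'rV[R]_0 M).
  by move=> x y _; rewrite (thinmx0 x) (thinmx0 y).
have idsurj (x : M) : exists y, (idfun : {linear M -> M}) y = x by exists x.
have idker (y : M) : (idfun : {linear M -> M}) y = 0 <->
    exists z, lin0 'rV[R]_0 M z = y.
  by split=> [/= ->|[_ <-]//]; exists 0.
exists (short_res (@zero_projective R) hM inj0 idsurj idker).
by case=> [|[|k]] // _ x; exact: thinmx0.
Qed.

(** The cokernel of the telescope has projective dimension at most 1, hence 0; so the telescope has
    a retraction, which solves the extension problem with a = 1. *)
Lemma Fdim0_pi_regular : is_Fdim R 0 ->
  forall s : R, exists n r, s ^+ n = s ^+ n.+1 * r.
Proof.
move=> [hub _] s; pose t := telescope_map s.
have tinj : injective t := @telescope_map_inj R s.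
have hF := @free_projective R nat.
have aker y : qpi (ims t) y = 0 <-> exists z, t z = y by exact: qpi_eq0.
have asurj := @qpi_surj _ _ (ims t).
have pd1 := short_pdim_le1 hF hF tinj asurj aker.
have [n pn nmin] : exists2 n, pdim_le (quotmod (ims t)) n &
    forall m, pdim_le (quotmod (ims t)) m -> (n <= m)%N.
  pose P n := `[< pdim_le (quotmod (ims t)) n >].
  have [n /asboolP pn nmin] := ex_minnP (ex_intro P 1%N (asboolT pd1)).
  by exists n => // m pm; apply: nmin; exact/asboolP.
have : (n <= 0)%N by apply: (hub n); exists (quotmod (ims t)).
rewrite leqn0 => /eqP n0; rewrite {}n0 in pn.
have hM := pdim_le0_projective pn.
have [sg hsg] := hM _ _ (qpi (ims t)) idfun asurj.
have [r hr] : exists r : {linear free_module R nat -> free_module R nat}, forall x,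
    t (r x) = ((idfun : {linear free_module R nat -> _}) \- (sg \o qpi (ims t))) x.
  apply: proj_lift => // x; apply/aker.
  suff : qpi (ims t) (x - sg (qpi (ims t) x)) = 0 by [].
  by rewrite linearB hsg subrr.
have hrt x : r (t x) = x.
  apply: tinj; rewrite hr -[LHS]/(t x - sg (qpi (ims t) (t x))).
  have -> : qpi (ims t) (t x) = 0 by apply/aker; exists x.
  by rewrite (linear0 sg) subr0.
have [m [z e]] := @telescope_extension R s R^o 1 idfun r (fun n => erefl) hrt.
by exists m, z; move: e; rewrite /GRing.scale /= mulr1.
Qed.

(** Non zero divisors are units, so every injection of projectives splits. A finite projective
    resolution then splits from its left end. *)
Lemma pi_regular_Fdim0 : noetherian R -> pi_regular_fractions R ->
  (forall u : R, GRing.lreg u -> exists t, t * u = 1) -> is_Fdim R 0.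
Proof.
move=> hR hpi hunit.
have bij (Y : lmodType R) : regular_bijective Y.
  move=> u /hunit[t tu]; split=> y.
    by move=> uy; rewrite -[y]scale1r -tu -scalerA uy scaler0.
  by exists (t *: y); rewrite scalerA mulrC tu scale1r.
have split_mono (A B : lmodType R) (f : {linear A -> B}) : projective A ->
    projective B -> injective f -> exists g : {linear B -> A}, forall x, g (f x) = x.
  move=> hA hB finj.
  by have [g hg] := regular_bijective_ext hR hpi hA hB finj (bij A) idfun; exists g.
have fin_proj (M : lmodType R) n : pdim_le M n -> projective M.
  move=> [P hP]; pose D k := res_diff P k.
  have vN k : exists h : {linear P k -> P k.+1}, forall x, D k (h (D k x)) = D k x.
    have [m] : exists m, (n <= k + m)%N by exists n; rewrite leq_addl.
    elim: m k => [|m IH] k nk.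
      exists (lin0 _ _) => x; rewrite (hP k.+1 _ x) ?linear0 //.
      by rewrite ltnS -[k]addn0.
    have [|h hh] := IH k.+1; first by rewrite addSnnS.
    (* An idempotent with image ker D_k; its kernel S is a projective complement, on which D_k is
       injective and hence splits. *)
    pose e := D k.+1 \o h; pose S := kers e.
    have eE x : e x = D k.+1 (h x) by [].
    have kerS x : S (x - e x).
      suff : D k.+1 (h (x - D k.+1 (h x))) = 0 by [].
      by rewrite (linearB h) (linearB (D k.+1)) hh subrr.
    pose p := corestr (f := (idfun : {linear P k.+1 -> _}) \- e) kerS.
    have pS x : p (sincl S x) = x.
      apply: sincl_inj; rewrite corestrE -[LHS]/(sincl S x - e (sincl S x)).
      have -> : e (sincl S x) = 0 by exact: (sinclP x).
      by rewrite subr0.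
    have hS : projective (submod_type S).
      exact: (retract_projective pS (@res_proj _ _ P k.+1)).
    have De x : D k (e x) = 0 by apply/res_exactS; exists (h x).
    have DS : injective (D k \o sincl S).
      apply: eq0_inj => x /res_exactS[z hz]; apply: sincl_inj; rewrite linear0.
      have <- : e (sincl S x) = 0 by exact: (sinclP x).
      by rewrite eE -hz hh.
    have [g hg] := split_mono _ _ _ hS (@res_proj _ _ P k) DS.
    exists (sincl S \o g) => x.
    have DE : D k x = (D k \o sincl S) (p x).
      by rewrite -[RHS]/(D k (x - e x)) linearB De subr0.
    by rewrite {1}DE -[LHS]/(D k (sincl S (g ((D k \o sincl S) (p x))))) hg DE.
  (* This e kills the image of D_0, so it induces a section of the augmentation. *)
  have [h hh] := vN 0%N; pose e : {linear P 0%N -> P 0%N} :=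
    (idfun : {linear P 0%N -> P 0%N}) \- (D 0%N \o h).
  have [s hs] := choice (@res_surj _ _ P).
  have sl : linear (e \o s).
    move=> a x y.
    have /res_exact0[z hz] : res_aug P (s (a *: x + y) - (a *: s x + s y)) = 0.
      by rewrite linearB linearP !hs subrr.
    have : e (D 0%N z) = 0.
      by suff : D 0%N z - D 0%N (h (D 0%N z)) = 0 by []; rewrite hh subrr.
    by rewrite [D 0%N z]hz (linearB e) (linearP e) => /eqP; rewrite subr_eq0 => /eqP.
  apply: (@retract_projective _ _ _ (mkLin sl) (res_aug P) _ (@res_proj _ _ P 0)) => x.
  rewrite -[LHS]/(res_aug P (s x - D 0%N (h (s x)))) linearB hs.
  have -> : res_aug P (D 0%N (h (s x))) = 0 by apply/res_exact0; exists (h (s x)).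
  by rewrite subr0.
split=> [n [M [pn nmin]]|m hm]; last by [].
by apply: nmin; apply: projective_pdim_le0; apply: fin_proj pn.
Qed.

End FinitisticDimension.

(** * Finite type and the non zero divisors *)

Section FiniteType.
Variable R : comPzRingType.
Hypothesis noethR : noetherian R.

Lemma finite_type_pi_regular :
  cotorsion_pair_of_finite_type (pdim_le1 R) (right_perp (pdim_le1 R)) ->
  pi_regular_fractions R.
Proof.
move=> [[hA _] [S [Sfg hS]]].
pose Y : lmodType R := fracs R nat.
have Ydiv : divisible Y by move=> u ureg; exact: (@fracs_bijective R nat u ureg).2.
(* S lies in the left orthogonal of S^perp = P_1^perp, which is P_1. *)
have SP M : S M -> pdim_le1 R M.
  by move=> SM; apply/hA => N /hS hN; exact: hN.
have /hS/right_perp_pdim_le1P hY : right_perp S Y.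
  move=> M SM; apply: fg_ext_divisible => //; [exact: Sfg | exact: SP].
apply: pi_regular_of_total_fractions => s.
have [g hg] := hY _ _ (telescope_map s) (@free_projective R nat)
  (@free_projective R nat) (@telescope_map_inj R s) (to_fracs R nat).
have [|n [z e]] := telescope_extension (a := 1 : qmod R) _ hg.
  by move=> n; exact: linext_delta.
exists n, z; move: e; rewrite !qmodZ mulr1 !rmorphXn; exact.
Qed.

(** S consists of the modules R/uR, each given by its presentation; extension along multiplication
    by u is divisibility by u. *)
Lemma pi_regular_finite_type : pi_regular_fractions R ->
  cotorsion_pair_of_finite_type (pdim_le1 R) (right_perp (pdim_le1 R)).
Proof.
move=> hpi; split; first exact: pdim_le1_hereditary.
pose mu u := mkLin (@scale_linear R R^o u).
have hR : projective R^o.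
  move=> A B g f gsurj; have [a ga] := gsurj (f 1).
  have hl : linear (fun r : R^o => r *: a).
    by move=> c x y; rewrite scalerDl -scalerA.
  exists (mkLin hl) => x; rewrite -[LHS]/(g (x *: a)) linearZ_LR ga -linearZ_LR.
  by congr (f _); exact: mulr1.
pose S (M : lmodType R) := exists2 u : R, GRing.lreg u &
  exists a : {linear R^o -> M}, (forall x, exists y, a y = x) /\
    forall y, a y = 0 <-> exists z, mu u z = y.
exists S; split=> [M [u ureg [a [asurj aker]]]|Y].
  exists (short_res hR hR (d := mu u) ureg asurj aker) => n.
  have R1 : finitely_generated R^o.
    exists 1%N, (fun=> 1) => x; exists (fun=> x).
    by rewrite big_ord1; exact/esym/mulr1.
  have Z0 : finitely_generated 'rV[R]_0.
    by exists 0%N, (fun=> 0) => x; exists (fun=> 0); rewrite (thinmx0 x) big_ord0.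
  by case: n => [|[|n]].
split=> [hY|hY M [u ureg [a [asurj aker]]]]; last first.
  by apply: hY; exact: (short_pdim_le1 hR hR (d := mu u) ureg asurj aker).
apply: divisible_right_perp => // u ureg y.
have aker w : qpi (ims (mu u)) w = 0 <-> exists z, mu u z = w by exact: qpi_eq0.
have asurj := @qpi_surj _ _ (ims (mu u)).
have fl : linear (fun r : R^o => r *: y).
  by move=> c x z; rewrite scalerDl -scalerA.
have [g hg] : exists g : {linear R^o -> Y}, forall x, g (mu u x) = mkLin fl x.
  apply: (ext_along_of_Ext_eq0 hR hR (d := mu u) ureg asurj aker).
  by apply: hY => //; exists u => //; exists (qpi (ims (mu u))).
(* The extension g satisfies u g(1) = g(u) = y. *)
exists (g 1); rewrite -linearZ_LR; have := hg 1.
by rewrite -[RHS]/(1 *: y) scale1r.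
Qed.

End FiniteType.

Theorem theorem8p4 (R : comPzRingType) (hR : noetherian R) :
  let Q : comPzRingType := total_fractions R in
  [<-> cotorsion_pair_of_finite_type (pdim_le1 R) (right_perp (pdim_le1 R));
       is_Fdim Q 0;
       artinian Q;
       associated_primes R = minimal_primes R].
Proof.
move=> Q.
have hQ : noetherian Q := noetherian_total_fractions hR.
have toQ : pi_regular_fractions R -> forall q : Q, exists n r, q ^+ n = q ^+ n.+1 * r.
  exact: pi_regular_total_fractions.
have ofQ : (forall q : Q, exists n r, q ^+ n = q ^+ n.+1 * r) -> pi_regular_fractions R.
  by move=> h; apply: pi_regular_of_total_fractions => s; exact: h.
tfae.
- move=> /(finite_type_pi_regular hR)/toQ hpi; apply: pi_regular_Fdim0 => //.
    move=> q; have [n [r e]] := hpi q; exists n, 1, r.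
    by rewrite mul1r; split=> //; exact: lreg1.
  exact: total_fractions_lreg_unit.
- by move=> /Fdim0_pi_regular hpi; exact: noetherian_pi_regular_artinian.
- by move=> /artinian_pi_regular/ofQ; exact: associated_primesE.
- by move=> /(pi_regular_of_associated hR); exact: pi_regular_finite_type.
Qed.
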